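(* Let $X,Y=(y_1,\dots,y_n)\in\mathcal M_{p,n}$ be random matrices and $D\in\mathcal D_n$ a random diagonal matrix such that $(X,Y,D)\propto\mathcal E_2$, $\|\mathbb E[X]\|\le O(\sqrt{p+n})$ and $\|\mathbb E[D]\|,\ \sup_{1\le i\le n}\|\mathbb E[y_i]\|\le O(1)$. Then for any deterministic vector $u\in\mathbb R^p$ such that $\|u\|\le1$, $$XDY^Tu\propto\mathcal E_2\left(\sqrt{(p+n)\log(np)}\right)+\mathcal E_1\left(\sqrt{p+n}\right)+\mathcal E_{2/3}\qquad\text{in }(\mathbb R^p,\|\cdot\|).$$
   Context: $\mathcal M_{p,n}$ is the set of real $p\times n$ matrices, $\mathcal D_n$ the set of $n\times n$ diagonal matrices; $\|\cdot\|$ is the Euclidean norm on vectors and the spectral norm on matrices, $\|\cdot\|_F$ the Frobenius norm. All objects are sequences indexed by the dimensions $(p,n)$; $a\le O(b)$ means $a\le Cb$ for a constant $C>0$ independent of the indices. For a (sequence of) random vectors $Z$ in a normed space $(E,\|\cdot\|_E)$, $Z\propto\sum_l\mathcal E_{q_l}(\sigma_l)$ means: there exist constants $C,c>0$ independent of the indices such that for all $1$-Lipschitz $f:E\to\mathbb R$ and all $t>0$, $\mathbb P(|f(Z)-\mathbb E[f(Z)]|\ge t)\le C\sum_le^{-(t/(c\sigma_l))^{q_l}}$. One writes $\mathcal E_q$ for $\mathcal E_q(1)$. The hypothesis $(X,Y,D)\propto\mathcal E_2$ is for the product norm built from the Frobenius norms on $\mathcal M_{p,n}\times\mathcal M_{p,n}\times\mathcal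 D_n$. *)

(* Defs.v *)
(* MathComp-Analysis, over an arbitrary realType. *)
From HB Require Import structures.
From mathcomp Require Import all_boot all_order all_algebra.
From mathcomp Require Import all_classical all_reals all_analysis.

Set Implicit Arguments.
Unset Strict Implicit.
Unset Printing Implicit Defensive.
Import Order.TTheory GRing.Theory Num.Theory.
Local Open Scope classical_set_scope.
Local Open Scope ring_scope.

Section DiagonalMatrices.
Variables (R : realType) (n : nat).

Lemma is_diag_mx_submod : submod_closed (@is_diag_mx R n n).
Proof.
split=> [|a A B /is_diag_mxP dA /is_diag_mxP dB]; first exact: mx0_is_diag.
by apply/is_diag_mxP => i j ij; rewrite !mxE dA// dB// mulr0 addr0.
Qed.

HB.instance Definition _ :=
  GRing.isSubmodClosed.Build R 'M[R]_n (@is_diag_mx R n n) is_diag_mx_submod.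

Record diagmx := DiagMx { diagmx_val :> 'M[R]_n ; _ : is_diag_mx diagmx_val }.

HB.instance Definition _ := [isSub for diagmx_val].
HB.instance Definition _ := [Choice of diagmx by <:].
HB.instance Definition _ := [SubChoice_isSubZmodule of diagmx by <:].
HB.instance Definition _ := [SubZmodule_isSubLmodule of diagmx by <:].

End DiagonalMatrices.

Section Norms.
Variable R : realType.

Definition enorm (p : nat) (x : 'cV[R]_p) : R :=
  Num.sqrt (\sum_(i < p) x i ord0 ^+ 2).

Definition frobnorm (p n : nat) (A : 'M[R]_(p, n)) : R :=
  Num.sqrt (\sum_(i < p) \sum_(j < n) A i j ^+ 2).

Definition specnorm (p n : nat) (A : 'M[R]_(p, n)) : R :=
  sup [set enorm (A *m x) | x in [set x : 'cV[R]_n | enorm x <= 1]].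

(* Any other usual product norm on three factors differs from this one only by
   a numerical factor, which the constants in concentrated absorb. *)
Definition prodnorm (p n : nat)
    (z : 'M[R]_(p, n) * 'M[R]_(p, n) * diagmx R n) : R :=
  Num.max (Num.max (frobnorm z.1.1) (frobnorm z.1.2)) (frobnorm z.2).

End Norms.

Section Randomness.
Context {R : realType} {d : measure_display} {T : measurableType d}.

Definition random_matrix (p n : nat) (X : T -> 'M[R]_(p, n)) : Prop :=
  forall i j, measurable_fun [set: T] (fun w => X w i j).

Definition mean_matrix (P : probability T R) (p n : nat)
    (X : T -> 'M[R]_(p, n)) : 'M[R]_(p, n) :=
  \matrix_(i < p, j < n) fine 'E_P[fun w => X w i j].

End Randomness.

(* Every sequence is indexed by the dimensions (p, n), both at least 1;
   le_bigO a b is a <= O(b), not a bound on absolute values. *)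

Definition le_bigO {R : realType} (a b : nat -> nat -> R) : Prop :=
  exists2 C : R, 0 < C &
    forall p n : nat, (0 < p)%N -> (0 < n)%N -> a p n <= C * b p n.

Definition lipschitz1 {R : realType} (E : lmodType R) (nrm : E -> R)
    (f : E -> R) : Prop :=
  forall x y : E, `|f x - f y| <= nrm (x - y).

(* e^{-(t / (c sigma))^q}, with the value e^{-oo} = 0 when sigma = 0
   (division by zero would give 1 instead). *)
Definition exp_tail {R : realType} (c q sigma t : R) : R :=
  if sigma == 0 then 0 else expR (- ((t / (c * sigma)) `^ q)).

(* Z \propto \sum_l E_{q_l}(sigma_l), where s p n is the list of the pairs
   (q_l, sigma_l) at dimensions (p, n); integrability says that E[f(Z)], which
   centres the deviations, exists. *)
Definition concentrated {R : realType} {d : nat -> nat -> measure_display}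
    {T : forall p n : nat, measurableType (d p n)}
    (P : forall p n : nat, probability (T p n) R)
    {E : nat -> nat -> lmodType R} (nrm : forall p n : nat, E p n -> R)
    (Z : forall p n : nat, T p n -> E p n)
    (s : nat -> nat -> seq (R * R)) : Prop :=
  exists C c : R, [/\ 0 < C, 0 < c &
    forall p n : nat, (0 < p)%N -> (0 < n)%N ->
    forall f : E p n -> R, lipschitz1 (@nrm p n) f ->
      (P p n).-integrable [set: T p n] (fun w => (f (Z p n w))%:E) /\
      forall t : R, 0 < t ->
        (P p n [set w | (t <= `| f (Z p n w)
                              - fine 'E_(P p n)[fun w' => f (Z p n w')] |)%R]
         <= (C * \sum_(l <- s p n) exp_tail c l.1 l.2 t)%:E)%E ].

(* Main.v *)
(* Fix a 1-Lipschitz [f] and let [al = sqrt (p + n)], [be = sqrt (1 + ln (np))].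
   Up to an event of probability [O(exp(-(s/c)^2))], the norms of [X] and of
   [Y^T u] are [O(al + s)], while the diagonal of [D] and the coordinates of
   [Y^T u] are [O(be + s)]: for the operator norms this is a union bound over a
   net of [exp(O(p + n))] pairs of vectors, for the coordinates over [O(n)]
   linear functionals.  On the complement, [(X, Y, D) |-> f (X D Y^T u)] is
   Lipschitz with constant [O((al + s) (be + s))]; McShane's extension to the
   whole space inherits the concentration hypothesis.  The extensions at two
   levels agree with large probability, so all their means are within
   [O(s (al + s) (be + s))] of a common constant, and integrating the tail shows
   that the actual mean is within [O(al be)] of it.  Hence deviations of size
   [K s (al + s) (be + s)] have probability [O(exp(-(s/c)^2))]; expanding the
   product into [s al be], [s^2 al] and [s^3] gives the three tails. *)
Require Import Defs.
From mathcomp Require Import all_boot all_order all_algebra.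
From mathcomp Require Import all_classical all_reals all_analysis.
From mathcomp Require Import measurable_realfun ring lra.

Set Implicit Arguments.
Unset Strict Implicit.
Unset Printing Implicit Defensive.
Import Order.TTheory GRing.Theory Num.Theory.
Local Open Scope classical_set_scope.
Local Open Scope ring_scope.

(** * Euclidean, Frobenius and spectral norms *)

Section EuclideanNorms.
Variable R : realType.

(** Indexed by any finite type, so that vectors and matrix entries share one Cauchy-Schwarz and one
    triangle inequality. *)
Definition l2norm (I : finType) (a : I -> R) : R := Num.sqrt (\sum_i a i ^+ 2).

Lemma l2norm_ge0 (I : finType) (a : I -> R) : 0 <= l2norm a.
Proof. exact: sqrtr_ge0. Qed.

Lemma sqr_l2norm (I : finType) (a : I -> R) : l2norm a ^+ 2 = \sum_i a i ^+ 2.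
Proof. by rewrite sqr_sqrtr// sumr_ge0// => i _; rewrite sqr_ge0. Qed.

Lemma l2norm_eq0 (I : finType) (a : I -> R) i : l2norm a = 0 -> a i = 0.
Proof.
move=> a0; have /eqP := sqr_l2norm a; rewrite a0 expr0n/= eq_sym.
rewrite psumr_eq0; last by move=> j _; rewrite sqr_ge0.
by move=> /allP/(_ i); rewrite mem_index_enum sqrf_eq0 => /(_ isT)/eqP.
Qed.

(** Expanding [\sum_i (l2norm b * a i - l2norm a * b i) ^+ 2 >= 0] gives the claim multiplied by
    [2 * l2norm a * l2norm b]; hence zero norms are split off. *)
Lemma cauchy_schwarz (I : finType) (a b : I -> R) :
  \sum_i a i * b i <= l2norm a * l2norm b.
Proof.
have [a0|a0] := eqVneq (l2norm a) 0.
  by rewrite big1 ?a0 ?mul0r// => i _; rewrite (l2norm_eq0 i a0) mul0r.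
have [b0|b0] := eqVneq (l2norm b) 0.
  by rewrite big1 ?b0 ?mulr0// => i _; rewrite (l2norm_eq0 i b0) mulr0.
have ab : 0 < l2norm a * l2norm b by rewrite mulr_gt0// lt0r ?a0 ?b0 l2norm_ge0.
rewrite -(ler_pM2l ab).
have : 0 <= \sum_i (l2norm b * a i - l2norm a * b i) ^+ 2.
  by rewrite sumr_ge0// => i _; rewrite sqr_ge0.
have -> : \sum_i (l2norm b * a i - l2norm a * b i) ^+ 2 =
    l2norm b ^+ 2 * \sum_i a i ^+ 2 - 2 * (l2norm a * l2norm b) * \sum_i a i * b i
    + l2norm a ^+ 2 * \sum_i b i ^+ 2.
  rewrite !mulr_sumr -sumrB -big_split/=; apply: eq_bigr => i _; ring.
rewrite -!sqr_l2norm => h; nra.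
Qed.

Lemma cauchy_schwarz_norm (I : finType) (a b : I -> R) :
  `|\sum_i a i * b i| <= l2norm a * l2norm b.
Proof.
rewrite ler_norml cauchy_schwarz andbT lerNl -sumrN.
have -> : l2norm a = l2norm (fun i => - a i).
  by congr Num.sqrt; apply: eq_bigr => i _; rewrite sqrrN.
by apply: le_trans (cauchy_schwarz _ _); apply: ler_sum => i _; rewrite mulNr.
Qed.

Lemma l2norm_le (I : finType) (a : I -> R) (c : R) : 0 <= c ->
  \sum_i a i ^+ 2 <= c ^+ 2 -> l2norm a <= c.
Proof. by move=> c0; rewrite -sqr_l2norm ler_sqr ?nnegrE ?l2norm_ge0. Qed.

Lemma l2normD (I : finType) (a b : I -> R) :
  l2norm (fun i => a i + b i) <= l2norm a + l2norm b.
Proof.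
apply: l2norm_le; first by rewrite addr_ge0// l2norm_ge0.
have -> : \sum_i (a i + b i) ^+ 2 =
    \sum_i a i ^+ 2 + 2 * \sum_i a i * b i + \sum_i b i ^+ 2.
  by rewrite mulr_sumr -!big_split/=; apply: eq_bigr => i _; ring.
rewrite -!sqr_l2norm; have := cauchy_schwarz a b; lra.
Qed.

Lemma ler_l2norm (I : finType) (a : I -> R) i : `|a i| <= l2norm a.
Proof.
rewrite -ler_sqr ?nnegrE ?l2norm_ge0// sqr_l2norm real_normK ?num_real//.
by rewrite (bigD1 i)//= lerDl sumr_ge0// => j _; rewrite sqr_ge0.
Qed.

Lemma enormE p (x : 'cV[R]_p) : enorm x = l2norm (fun i => x i ord0).
Proof. by []. Qed.

Lemma frobnormE p n (A : 'M[R]_(p, n)) :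
  frobnorm A = l2norm (fun ij : 'I_p * 'I_n => A ij.1 ij.2).
Proof. by rewrite /frobnorm /l2norm pair_bigA. Qed.

Lemma enorm_ge0 p (x : 'cV[R]_p) : 0 <= enorm x.
Proof. exact: l2norm_ge0. Qed.

Lemma frobnorm_ge0 p n (A : 'M[R]_(p, n)) : 0 <= frobnorm A.
Proof. exact: sqrtr_ge0. Qed.

Lemma sqr_enorm p (x : 'cV[R]_p) : enorm x ^+ 2 = \sum_i x i ord0 ^+ 2.
Proof. exact: sqr_l2norm. Qed.

Lemma sqr_frobnorm p n (A : 'M[R]_(p, n)) :
  frobnorm A ^+ 2 = \sum_i \sum_j A i j ^+ 2.
Proof. by rewrite frobnormE sqr_l2norm pair_bigA. Qed.

Lemma enormD p (x y : 'cV[R]_p) : enorm (x + y) <= enorm x + enorm y.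
Proof.
apply: le_trans (l2normD _ _); rewrite enormE le_eqVlt; apply/orP; left.
by apply/eqP; congr l2norm; apply/funext => i; rewrite !mxE.
Qed.

Lemma enormZ p (a : R) (x : 'cV[R]_p) : enorm (a *: x) = `|a| * enorm x.
Proof.
rewrite /enorm -sqrtr_sqr -sqrtrM ?sqr_ge0// mulr_sumr.
by congr Num.sqrt; apply: eq_bigr => i _; rewrite mxE exprMn.
Qed.

Lemma enorm0 p : enorm (0 : 'cV[R]_p) = 0.
Proof. by rewrite -(scale0r 0) enormZ normr0 mul0r. Qed.

Lemma enorm_eq0 p (x : 'cV[R]_p) : enorm x = 0 -> x = 0.
Proof.
by move=> x0; apply/colP => i; rewrite mxE (@l2norm_eq0 _ (fun i => x i ord0)).
Qed.

Lemma enorm_delta p (i : 'I_p) : enorm (delta_mx i ord0 : 'cV[R]_p) = 1.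
Proof.
rewrite /enorm (bigD1 i)//= big1 ?addr0 ?mxE ?eqxx ?expr1n ?sqrtr1//.
by move=> j /negbTE ji; rewrite mxE ji expr0n.
Qed.

Lemma frobnormD p n (A B : 'M[R]_(p, n)) :
  frobnorm (A + B) <= frobnorm A + frobnorm B.
Proof.
rewrite !frobnormE; apply: le_trans (l2normD _ _); rewrite le_eqVlt.
by apply/orP; left; apply/eqP; congr l2norm; apply/funext => i; rewrite !mxE.
Qed.

Lemma frobnormN p n (A : 'M[R]_(p, n)) : frobnorm (- A) = frobnorm A.
Proof.
congr Num.sqrt; apply: eq_bigr => i _; apply: eq_bigr => j _.
by rewrite mxE sqrrN.
Qed.

Lemma frobnorm0 p n : frobnorm (0 : 'M[R]_(p, n)) = 0.
Proof.
rewrite /frobnorm big1 ?sqrtr0// => i _; rewrite big1// => j _.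
by rewrite mxE expr0n.
Qed.

Lemma frobnorm_tr p n (A : 'M[R]_(p, n)) : frobnorm A^T = frobnorm A.
Proof.
rewrite /frobnorm exchange_big; congr Num.sqrt.
by apply: eq_bigr => i _; apply: eq_bigr => j _; rewrite mxE.
Qed.

Lemma ler_frobnorm p n (A : 'M[R]_(p, n)) i j : `|A i j| <= frobnorm A.
Proof.
by rewrite frobnormE; exact: (ler_l2norm (fun ij : 'I_p * 'I_n => A ij.1 ij.2) (i, j)).
Qed.

Lemma enorm_mulmx p n (A : 'M[R]_(p, n)) (x : 'cV[R]_n) :
  enorm (A *m x) <= frobnorm A * enorm x.
Proof.
apply: l2norm_le; first by rewrite mulr_ge0 ?frobnorm_ge0 ?enorm_ge0.
rewrite exprMn sqr_frobnorm mulr_suml; apply: ler_sum => i _.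
rewrite -(sqr_l2norm (A i)) -exprMn -[leLHS]real_normK ?num_real//.
rewrite ler_sqr ?nnegrE// ?mulr_ge0 ?l2norm_ge0//.
by rewrite mxE; exact: cauchy_schwarz_norm.
Qed.

(** * Bilinear forms and operator norms *)

Definition bilin p n (M : 'M[R]_(p, n)) (v : 'cV[R]_p) (x : 'cV[R]_n) : R :=
  \sum_i \sum_j v i ord0 * M i j * x j ord0.

Lemma bilinE p n (M : 'M[R]_(p, n)) v x :
  bilin M v x = \sum_i v i ord0 * (M *m x) i ord0.
Proof.
apply: eq_bigr => i _; rewrite mxE mulr_sumr.
by apply: eq_bigr => j _; rewrite mulrA.
Qed.

Lemma bilin_tr p n (M : 'M[R]_(p, n)) v x : bilin M^T x v = bilin M v x.
Proof.
rewrite /bilin exchange_big; apply: eq_bigr => i _; apply: eq_bigr => j _.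
by rewrite mxE; ring.
Qed.

Lemma bilinBl p n (M : 'M[R]_(p, n)) v w x :
  bilin M (v - w) x = bilin M v x - bilin M w x.
Proof.
rewrite !bilinE -sumrB; apply: eq_bigr => i _.
by rewrite !mxE mulrBl.
Qed.

Lemma bilinBr p n (M : 'M[R]_(p, n)) v x y :
  bilin M v (x - y) = bilin M v x - bilin M v y.
Proof. by rewrite -!(bilin_tr M) bilinBl. Qed.

Lemma bilinZl p n (M : 'M[R]_(p, n)) a v x :
  bilin M (a *: v) x = a * bilin M v x.
Proof.
rewrite !bilinE mulr_sumr; apply: eq_bigr => i _.
by rewrite !mxE mulrA.
Qed.

Lemma bilinZr p n (M : 'M[R]_(p, n)) a v x :
  bilin M v (a *: x) = a * bilin M v x.
Proof. by rewrite -!(bilin_tr M) bilinZl. Qed.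

Lemma bilin_subM p n (M N : 'M[R]_(p, n)) v x :
  bilin (M - N) v x = bilin M v x - bilin N v x.
Proof.
rewrite /bilin -sumrB; apply: eq_bigr => i _; rewrite -sumrB.
by apply: eq_bigr => j _; rewrite !mxE; ring.
Qed.

Lemma ler_bilin_mulmx p n (M : 'M[R]_(p, n)) v x :
  `|bilin M v x| <= enorm v * enorm (M *m x).
Proof.
by rewrite bilinE; exact: cauchy_schwarz_norm. Qed.

Lemma ler_bilin_frobnorm p n (M : 'M[R]_(p, n)) v x :
  enorm v <= 1 -> enorm x <= 1 -> `|bilin M v x| <= frobnorm M.
Proof.
move=> v1 x1; apply: le_trans (ler_bilin_mulmx _ _ _) _.
rewrite -[leRHS]mul1r ler_pM ?enorm_ge0//.
apply: le_trans (enorm_mulmx _ _) _.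
by rewrite -[leRHS]mulr1 ler_wpM2l// frobnorm_ge0.
Qed.

(** On the normalizations of [M *m x] and [x] the form equals [enorm (M *m x) / enorm x]. *)
Lemma enorm_mulmx_bilin p n (M : 'M[R]_(p, n)) (r : R) :
  (forall v x, enorm v <= 1 -> enorm x <= 1 -> `|bilin M v x| <= r) ->
  forall x, enorm (M *m x) <= r * enorm x.
Proof.
move=> h x.
have [->|x0] := eqVneq x 0; first by rewrite mulmx0 !enorm0 mulr0.
have [->|Mx0] := eqVneq (M *m x) 0.
  rewrite enorm0 mulr_ge0 ?enorm_ge0//.
  by apply: le_trans (h 0 0 _ _); rewrite ?enorm0 ?normr_ge0.
have xp : 0 < enorm x.
  by rewrite lt0r enorm_ge0 andbT; apply: contra_neq x0; exact: enorm_eq0.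
have Mxp : 0 < enorm (M *m x).
  by rewrite lt0r enorm_ge0 andbT; apply: contra_neq Mx0; exact: enorm_eq0.
have u1 q (y : 'cV[R]_q) : 0 < enorm y -> enorm ((enorm y)^-1 *: y) <= 1.
  by move=> y0; rewrite enormZ gtr0_norm ?invr_gt0// mulVf// gt_eqF.
have := h _ _ (u1 _ _ Mxp) (u1 _ _ xp).
rewrite bilinZl bilinZr; set b := bilin _ _ _.
have -> : b = enorm (M *m x) ^+ 2.
  by rewrite /b bilinE sqr_enorm; apply: eq_bigr => i _; rewrite expr2.
rewrite ger0_norm; last by rewrite !mulr_ge0 ?invr_ge0 ?sqr_ge0// ltW.
by rewrite mulrCA expr2 mulKf ?gt_eqF// ler_pdivrMl// mulrC.
Qed.

Lemma enorm_mulmx_specnorm p n (A : 'M[R]_(p, n)) x :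
  enorm (A *m x) <= specnorm A * enorm x.
Proof.
apply: enorm_mulmx_bilin => v {}x v1 x1.
apply: le_trans (ler_bilin_mulmx _ _ _) _.
rewrite -[leRHS]mul1r ler_pM ?enorm_ge0//.
apply: ub_le_sup; last by exists x.
(* A supremum bounds its set only if the set is bounded; the Frobenius norm provides the bound. *)
exists (frobnorm A) => _ [y /= y1 <-].
apply: le_trans (enorm_mulmx _ _) _.
by rewrite -[leRHS]mulr1 ler_wpM2l// frobnorm_ge0.
Qed.

Lemma ler_specnorm n (A : 'M[R]_n) i : `|A i i| <= specnorm A.
Proof.
have := enorm_mulmx_specnorm A (delta_mx i ord0).
rewrite enorm_delta mulr1; apply: le_trans.
have -> : A i i = (A *m (delta_mx i ord0 : 'cV[R]_n)) i ord0.
  rewrite mxE (bigD1 i)//= big1 ?addr0 ?mxE ?eqxx ?mulr1//.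
  by move=> j /negbTE ji; rewrite mxE ji mulr0.
exact: (ler_l2norm (fun k => (A *m (delta_mx i ord0 : 'cV[R]_n)) k ord0)).
Qed.

(** * Diagonal matrices acting on vectors *)

Lemma diag_mulmx n (A : 'M[R]_n) (x : 'cV[R]_n) i : is_diag_mx A ->
  (A *m x) i ord0 = A i i * x i ord0.
Proof.
move=> /is_diag_mxP dA; rewrite mxE (bigD1 i)//= big1 ?addr0// => j ji.
by rewrite dA ?mul0r// eq_sym.
Qed.

Lemma enorm_diag_mulmx n (A : 'M[R]_n) (x : 'cV[R]_n) r : is_diag_mx A ->
  0 <= r -> (forall i, `|A i i| <= r) -> enorm (A *m x) <= r * enorm x.
Proof.
move=> dA r0 Ar; apply: l2norm_le; first by rewrite mulr_ge0// enorm_ge0.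
rewrite exprMn sqr_enorm mulr_sumr; apply: ler_sum => i _.
rewrite diag_mulmx// exprMn ler_wpM2r ?sqr_ge0//.
by rewrite -real_normK ?num_real// ler_sqr ?nnegrE.
Qed.

(** The roles are reversed from [enorm_diag_mulmx]: a Frobenius perturbation of [D] then costs only
    the largest coordinate of [Y^T u], not its norm. *)
Lemma enorm_mulmx_diag n (A : 'M[R]_n) (x : 'cV[R]_n) r : is_diag_mx A ->
  0 <= r -> (forall i, `|x i ord0| <= r) -> enorm (A *m x) <= frobnorm A * r.
Proof.
move=> dA r0 xr; apply: l2norm_le; first by rewrite mulr_ge0// frobnorm_ge0.
rewrite exprMn sqr_frobnorm mulr_suml; apply: ler_sum => i _.
rewrite diag_mulmx// exprMn ler_pM ?sqr_ge0//.
  by rewrite (bigD1 i)//= lerDl sumr_ge0// => j _; rewrite sqr_ge0.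
by rewrite -real_normK ?num_real// ler_sqr ?nnegrE.
Qed.

End EuclideanNorms.

(** * A net for bilinear forms *)

Section Net.
Variable R : realType.

(* Integer vectors [k], stored as sign and absolute value, with
   [|k|^2 <= 16 n]; dividing by [4 sqrt n] gives points of the unit ball. *)
Definition net n : finType :=
  {k : {ffun 'I_n -> bool * 'I_(16 * n).+1} |
    (\sum_i (k i).2 ^ 2 <= 16 * n)%N}.

Definition net_point n (k : net n) : 'cV[R]_n :=
  \col_i ((-1) ^+ (val k i).1 * (val k i).2%:R / (4 * Num.sqrt n%:R)).

(* Chernoff: each admissible [k] has [1 <= 2 ^ (16 n - \sum_i |k_i|)], and the
   sum of the right-hand sides over all [k] factorizes. *)
Lemma card_net n : #|{: net n}|%:R <= 2 ^+ (18 * n) :> R.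
Proof.
rewrite card_sig.
pose f (a : bool * 'I_(16 * n).+1) : R := 2^-1 ^+ a.2.
have geo m : \sum_(j < m) (2^-1 : R) ^+ j <= 2.
  suff -> : \sum_(j < m) (2^-1 : R) ^+ j = 2 - 2 * 2^-1 ^+ m.
    by rewrite gerBl mulr_ge0// exprn_ge0// invr_ge0.
  elim: m => [|m ih]; first by rewrite big_ord0 expr0 mulr1 subrr.
  by rewrite big_ord_recr/= ih exprS; field.
(* Each of the two signs contributes a geometric series of sum at most 2. *)
have f4 : \sum_a f a <= 4.
  rewrite /f -(pair_bigA _ (fun (b : bool) (j : 'I_(16 * n).+1) => (2^-1 : R) ^+ j))/=.
  by rewrite big_bool/=; have := geo (16 * n).+1; lra.
have f0 a : 0 <= f a by rewrite exprn_ge0// invr_ge0.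
apply: (@le_trans _ _ (\sum_(k : {ffun 'I_n -> bool * 'I_(16 * n).+1})
    2 ^+ (16 * n) * \prod_i f (k i))).
  rewrite -sum1_card natr_sum big_mkcond/=; apply: ler_sum => k _.
  case: ifPn => [kn|_]; last by rewrite mulr_ge0 ?exprn_ge0 ?prodr_ge0.
  rewrite /f -expr_sum.
  set m := (\sum_i _)%N.
  have mn : (m <= 16 * n)%N.
    apply: leq_trans kn; apply: leq_sum => i _.
    by case: (nat_of_ord (k i).2) => // j; rewrite leq_pmulr.
  by rewrite exprVn ler_pdivlMr ?exprn_gt0// mul1r ler_weXn2l// ler1n.
rewrite -mulr_sumr -(bigA_distr_bigA (fun _ : 'I_n => f)) prodr_const card_ord.
have -> : 2 ^+ (18 * n) = 2 ^+ (16 * n) * 4 ^+ n :> R.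
  have <- : 2 ^+ 2 = 4 :> R by rewrite -natrX.
  by rewrite -exprM -exprD -mulnDl.
rewrite ler_wpM2l ?exprn_ge0//; apply: lerXn2r => //; rewrite nnegrE//.
by rewrite sumr_ge0.
Qed.

Lemma enorm_net_point n (k : net n) : enorm (net_point k) <= 1.
Proof.
apply: l2norm_le => //; rewrite expr1n.
case: n k => [|n] k; first by rewrite big_ord0.
have n0 : 0 < n.+1%:R :> R by rewrite ltr0n.
under eq_bigr do rewrite mxE expr_div_n exprMn sqrr_sign mul1r exprMn sqr_sqrtr ?ler0n//.
rewrite -mulr_suml ler_pdivrMr ?mulr_gt0 ?exprn_gt0// mul1r.
have /= := valP k; rewrite -(ler_nat R) natr_sum natrM.
under eq_bigr do rewrite natrX.
by rewrite -natrX.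
Qed.

(** With [s = 4 sqrt n], truncating each [s * x_i] towards zero keeps the integer vector admissible
    and moves each coordinate of [x] by at most [1 / s], hence [x] by at most [sqrt n / s = 1/4].
    Dimension 0 is separate because [s] vanishes there. *)
Lemma net_dense n (x : 'cV[R]_n) : enorm x <= 1 ->
  exists k : net n, enorm (x - net_point k) <= 4^-1.
Proof.
case: n x => [|n] x x1.
  have h : (\sum_(i < 0) (([ffun=> (true, ord0)] :
      {ffun 'I_0 -> bool * 'I_(16 * 0).+1}) i).2 ^ 2 <= 16 * 0)%N by rewrite big_ord0.
  by exists (exist (fun k : {ffun 'I_0 -> bool * 'I_(16 * 0).+1} =>
    is_true (\sum_i (k i).2 ^ 2 <= 16 * 0)%N) _ h); rewrite /enorm big_ord0 sqrtr0.
pose s : R := 4 * Num.sqrt n.+1%:R.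
have s0 : 0 < s by rewrite mulr_gt0// sqrtr_gt0 ltr0n.
have s2 : s ^+ 2 = (16 * n.+1)%:R.
  by rewrite exprMn sqr_sqrtr ?ler0n// natrM -natrX.
pose t i := Num.truncn (s * `|x i ord0|).
have tP i : (t i)%:R <= s * `|x i ord0| < (t i).+1%:R.
  by apply: truncn_itv; rewrite mulr_ge0// ltW.
have sum_t : (\sum_i t i ^ 2 <= 16 * n.+1)%N.
  rewrite -(ler_nat R) -s2 natr_sum.
  apply: (@le_trans _ _ (s ^+ 2 * enorm x ^+ 2)).
    rewrite sqr_enorm mulr_sumr; apply: ler_sum => i _.
    rewrite natrX -[x i ord0 ^+ 2]real_normK ?num_real// -exprMn.
    have /andP[ts _] := tP i.
    by rewrite ler_sqr ?nnegrE ?ler0n// (le_trans _ ts).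
  by rewrite -[leRHS]mulr1 ler_wpM2l ?sqr_ge0// expr_le1 ?enorm_ge0.
have t_lt i : (t i < (16 * n.+1).+1)%N.
  rewrite ltnS; apply: leq_trans sum_t.
  rewrite (bigD1 i)//=; apply: leq_trans (leq_addr _ _).
  by case: (t i) => // j; rewrite leq_pmulr.
pose k : {ffun 'I_n.+1 -> bool * 'I_(16 * n.+1).+1} :=
  [ffun i => (x i ord0 < 0, Ordinal (t_lt i))].
have h : (\sum_i (k i).2 ^ 2 <= 16 * n.+1)%N.
  by under eq_bigr do rewrite ffunE/=.
exists (exist (fun k : {ffun 'I_n.+1 -> bool * 'I_(16 * n.+1).+1} =>
  is_true (\sum_i (k i).2 ^ 2 <= 16 * n.+1)%N) k h); apply: l2norm_le => //.
apply: (@le_trans _ _ (\sum_(i < n.+1) s^-1 ^+ 2)).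
  apply: ler_sum => i _; rewrite !mxE/= ffunE/= -/s.
  have -> : x i ord0 - (-1) ^+ (x i ord0 < 0)%R * (t i)%:R / s =
      (-1) ^+ (x i ord0 < 0)%R * ((s * `|x i ord0| - (t i)%:R) / s).
    rewrite {1}(numEsign (x i ord0)); field; lra.
  rewrite exprMn sqrr_sign mul1r expr_div_n exprVn.
  rewrite -[leRHS]mul1r ler_wpM2r ?invr_ge0 ?sqr_ge0//.
  by have := tP i; rewrite -natr1 => /andP[? ?]; rewrite expr_le1//; lra.
rewrite sumr_const card_ord exprVn s2 natrM -[_ *+ n.+1]mulr_natr.
have n0 : n.+1%:R != 0 :> R by rewrite pnatr_eq0.
have -> : (16 * n.+1%:R)^-1 * n.+1%:R = 16^-1 :> R by field.
by rewrite exprVn -natrX.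
Qed.

(** Let [S] collect the values over both unit balls; it is bounded by the Frobenius norm. Moving
    [v], then [x], to the net costs [sup S / 4] each time, so [sup S <= r + sup S / 2]. *)
Lemma bilin_net p n (M : 'M[R]_(p, n)) (r : R) :
  (forall (k : net p) (l : net n),
     `|bilin M (net_point k) (net_point l)| <= r) ->
  forall v x, enorm v <= 1 -> enorm x <= 1 -> `|bilin M v x| <= 2 * r.
Proof.
move=> Mr.
pose S := [set `|bilin M vx.1 vx.2| | vx in
  [set vx : 'cV[R]_p * 'cV[R]_n | enorm vx.1 <= 1 /\ enorm vx.2 <= 1]].
have ubS : has_ubound S.
  by exists (frobnorm M) => _ [[v x] /= [v1 x1] <-]; exact: ler_bilin_frobnorm.
have leS v x : enorm v <= 1 -> enorm x <= 1 -> `|bilin M v x| <= sup S.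
  by move=> v1 x1; apply: ub_le_sup => //; exists (v, x).
have e4 q (w : 'cV[R]_q) : enorm w <= 4^-1 -> enorm (4 *: w) <= 1.
  by move=> w4; rewrite enormZ ger0_norm//; lra.
suff : sup S <= 2 * r by move=> Sr v x v1 x1; apply: le_trans (leS _ _ v1 x1) Sr.
suff : sup S <= r + sup S / 2 by lra.
apply: ge_sup.
  by exists `|bilin M 0 0|; exists (0, 0) => //=; rewrite !enorm0 !ler01.
move=> _ [[v x] /= [v1 x1] <-].
have [k kv] := net_dense v1; have [l lx] := net_dense x1.
set v0 := net_point k in kv; set x0 := net_point l in lx.
have -> : bilin M v x = bilin M v0 x0 + bilin M (v - v0) x + bilin M v0 (x - x0).
  by rewrite bilinBl bilinBr; ring.
have h1 : `|bilin M (v - v0) x| <= sup S / 4.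
  have := leS _ _ (e4 _ _ kv) x1.
  by rewrite bilinZl normrM ger0_norm//; lra.
have h2 : `|bilin M v0 (x - x0)| <= sup S / 4.
  have := leS _ _ (enorm_net_point k) (e4 _ _ lx).
  by rewrite bilinZr normrM ger0_norm// -/v0; lra.
have h0 := Mr k l; rewrite -/v0 -/x0 in h0.
apply: le_trans (ler_normD _ _) _.
by have := ler_normD (bilin M v0 x0) (bilin M (v - v0) x); lra.
Qed.

End Net.

(** * Tail integration *)

Section CubicTail.
Context {R : realType} {d : measure_display} {T : measurableType d}.
Variable P : probability T R.

Lemma measurable_set_le (f g : T -> R) : measurable_fun [set: T] f ->
  measurable_fun [set: T] g -> measurable [set w | f w <= g w].
Proof. by move=> mf mg; rewrite -[X in measurable X]setTI; exact: measurable_fun_le. Qed.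

Lemma measure_exists_le (J : finType) (B : J -> set T) :
  (forall j, measurable (B j)) ->
  measurable [set w | exists j, B j w] /\
  (P [set w | exists j, B j w] <= \sum_j P (B j))%E.
Proof.
move=> mB.
suff h (s : seq J) : measurable (\big[setU/set0]_(j <- s) B j) /\
    (P (\big[setU/set0]_(j <- s) B j) <= \sum_(j <- s) P (B j))%E.
  have -> : [set w | exists j, B j w] = \big[setU/set0]_(j <- enum J) B j.
    apply/seteqP; split=> w /=.
      by move=> [j Bj]; rewrite -bigcup_seq; exists j => //=; rewrite mem_enum.
    by rewrite -bigcup_seq => -[j _ Bj]; exists j.
  by have := h (enum J); rewrite [in X in _ /\ (_ <= X)%E]big_enum.
elim: s => [|j s [ms Ps]]; first by rewrite !big_nil measure0.
rewrite !big_cons; split; first exact: measurableU.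
by apply: le_trans (measureU2 _ _ _) _ => //; rewrite leeD2l.
Qed.

(** From the cubic term of the exponential series. At [x = (k / c) ^+ 2] it yields a decay in
    [k ^- 6], enough against a factor [(k + 1) ^+ 3]. *)
Lemma expR_cubic_le (x : R) : 0 < x -> expR (- x) <= 6 / x ^+ 3.
Proof.
move=> x0; rewrite expRN -[leLHS]mul1r ler_pdivrMr ?expR_gt0//.
have x3 : 0 < x ^+ 3 by rewrite exprn_gt0.
rewrite mulrAC ler_pdivlMr// mul1r.
have := @expR_ge1Dxn R x 2 (ltW x0); rewrite (_ : 3`! = 6)%N//; lra.
Qed.

(** For [k >= 1] this is [1 / (k (k + 1))]: a summable majorant with explicit partial sums. *)
Let telescope (k : nat) : R := if k is j.+1 then j.+1%:R^-1 - j.+2%:R^-1 else 1.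

Let sum_telescope n : \sum_(k < n) telescope k <= 2.
Proof.
case: n => [|n]; first by rewrite big_ord0.
suff -> : \sum_(k < n.+1) telescope k = 2 - n.+1%:R^-1.
  by rewrite gerBl invr_ge0.
elim: n => [|n ih]; first by rewrite big_ord1/= invr1; lra.
by rewrite big_ord_recr/= ih addrA subrK.
Qed.

(* Pointwise [V <= \sum_k a (k+1)^3 1_{V >= a k^3}]: look at the last [k] with
   [a k^3 <= V]. *)
Lemma integral_cubic_tail (V : T -> R) (a C c : R) :
  measurable_fun [set: T] V -> (forall w, 0 <= V w) ->
  0 < a -> 0 < C -> 0 < c ->
  (forall k : nat, (0 < k)%N -> (P [set w | (a * k%:R ^+ 3 <= V w)%R] <=
     (C * expR (- (k%:R / c) ^+ 2))%:E)%E) ->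
  (\int[P]_w (V w)%:E <= (a * (2 * (1 + 96 * C * c ^+ 6)))%:E)%E.
Proof.
move=> mV V0 a0 C0 c0 PV.
pose B k := [set w | a * k%:R ^+ 3 <= V w].
have mB k : measurable (B k) by apply: measurable_set_le.
pose f : nat -> T -> \bar R := fun k w => ((a * k.+1%:R ^+ 3)%:E * (\1_(B k) w)%:E)%E.
have f0 k w : (0 <= f k w)%E.
  by rewrite mule_ge0// lee_fin// mulr_ge0 ?ltW// exprn_ge0.
have mf k : measurable_fun [set: T] (f k).
  apply: emeasurable_funM; first exact: measurable_cst.
  by apply/measurable_EFinP; exact: measurable_indic.
have Vf w : ((V w)%:E <= \sum_(0 <= k <oo) f k w)%E.
  (* Take the least [k] with [V w < a (k + 1)^3]; minimality gives [a k^3 <= V w], and for [k = 0]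
     this is [V w >= 0]. *)
  have [k Bk Vk] : exists2 k : nat, B k w & V w < a * k.+1%:R ^+ 3.
    have ex : exists k : nat, V w < a * k.+1%:R ^+ 3.
      exists (Num.truncn (V w / a)).
      rewrite mulrC -ltr_pdivrMr//.
      apply: (@lt_le_trans _ _ (Num.truncn (V w / a)).+1%:R).
        have : 0 <= V w / a by rewrite divr_ge0// ltW.
        by move=> /truncn_itv/andP[].
      by rewrite ler_eXnr// ler1n.
    case: (ex_minnP ex) => k Vk min_k; exists k => //.
    case: k min_k {Vk} => [|k] min_k; first by rewrite /B/= expr0n/= mulr0.
    rewrite /B/= leNgt; apply/negP => Vk.
    by have := min_k _ Vk; rewrite ltnn.
  apply: (@le_trans _ _ (\sum_(0 <= j < k.+1) f j w)%E); last first.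
    by apply: nneseries_lim_ge => j _ _; exact: f0.
  rewrite big_nat_recr//=; apply: (@le_trans _ _ (f k w)).
    by rewrite /f indicE mem_set// mule1 lee_fin ltW.
  by rewrite leeDr// sume_ge0.
apply: (@le_trans _ _ (\int[P]_w \sum_(0 <= k <oo) f k w)%E).
  apply: ge0_le_integral => //.
  - by move=> w _; rewrite lee_fin.
  - exact/measurable_EFinP.
  - by apply: ge0_emeasurable_sum => // k w _ _; exact: f0.
rewrite integral_nneseries//.
pose M : R := a * (1 + 96 * C * c ^+ 6).
have M0 : 0 < M by rewrite mulr_gt0// addr_gt0// !mulr_gt0 ?exprn_gt0.
have fM k : (\int[P]_w f k w <= (M * telescope k)%:E)%E.
  rewrite /f ge0_integralZl_EFin//; last 2 first.
  - by apply/measurable_EFinP; exact: measurable_indic.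
  - by rewrite mulr_ge0 ?ltW// exprn_gt0.
  rewrite integral_indic// setIT.
  (* The tail hypothesis starts at level 1; at level 0 the probability is bounded by 1. *)
  case: k => [|k].
    rewrite expr1n mulr1/= mulr1; apply: (@le_trans _ _ (a%:E * 1)%E).
      by rewrite lee_wpmul2l ?probability_le1// lee_fin ltW.
    rewrite mule1 lee_fin /M ler_peMr//; first exact: ltW.
    by rewrite lerDl !mulr_ge0 ?exprn_ge0 ?ltW.
  apply: (@le_trans _ _ ((a * k.+2%:R ^+ 3)%:E * (C * expR (- (k.+1%:R / c) ^+ 2))%:E)%E).
    by rewrite lee_wpmul2l ?PV// lee_fin mulr_ge0 ?exprn_ge0// ltW.
  rewrite -EFinM lee_fin /=.
  have -> : k.+2%:R = k.+1%:R + 1 :> R by rewrite natr1.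
  have : 1 <= k.+1%:R :> R by rewrite ler1n.
  move: (k.+1%:R : R) => x x1.
  have x0 : 0 < x by lra.
  have xc : 0 < (x / c) ^+ 2 by rewrite exprn_gt0// divr_gt0.
  have -> : x^-1 - (x + 1)^-1 = (x * (x + 1))^-1 by field; lra.
  (* [x + 1 <= 2 x] gives the 8 and [expR_cubic_le] the 6; afterwards [x + 1 <= 2 x ^+ 2] turns 48
     into 96. *)
  apply: (@le_trans _ _ (a * (8 * x ^+ 3) * (C * (6 * c ^+ 6 / x ^+ 6)))).
    rewrite ler_pM//.
    - by rewrite mulr_ge0 ?exprn_ge0//; lra.
    - by rewrite mulr_ge0 ?expR_ge0// ltW.
    - rewrite ler_pM2l// (_ : 8 * x ^+ 3 = (2 * x) ^+ 3); last by ring.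
      by apply: lerXn2r; rewrite ?nnegrE; lra.
    - rewrite ler_pM2l//; apply: le_trans (expR_cubic_le xc) _.
      by rewrite le_eqVlt; apply/orP; left; apply/eqP; field; lra.
  apply: (@le_trans _ _ (a * (96 * C * c ^+ 6) / (x * (x + 1)))); last first.
    rewrite ler_wpM2r ?invr_ge0 ?mulr_ge0//; [lra|lra|].
    by rewrite /M ler_pM2l//; lra.
  rewrite ler_pdivlMr ?mulr_gt0//; last lra.
  have -> : a * (8 * x ^+ 3) * (C * (6 * c ^+ 6 / x ^+ 6)) * (x * (x + 1)) =
      a * (48 * C * c ^+ 6) * ((x + 1) / x ^+ 2) by field; lra.
  have -> : a * (96 * C * c ^+ 6) = a * (48 * C * c ^+ 6) * 2 by ring.
  rewrite ler_wpM2l//; first by rewrite !mulr_ge0 ?exprn_ge0 ?ltW.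
  by rewrite ler_pdivrMr ?exprn_gt0//; nra.
apply: lime_le.
  by apply: is_cvg_nneseries => k _ _; apply: integral_ge0.
apply: nearW => n; rewrite big_mkord.
apply: le_trans (lee_sum _ (fun (k : 'I_n) _ => fM k)) _.
rewrite sumEFin lee_fin -mulr_sumr.
have -> : a * (2 * (1 + 96 * C * c ^+ 6)) = M * 2 by rewrite /M; ring.
by rewrite ler_pM2l// sum_telescope.
Qed.

End CubicTail.

(** * Locally Lipschitz functions of a concentrated vector *)

Section Seminorm.
Context {R : realType} {E : lmodType R} (nrm : E -> R).
Hypothesis nrm0 : nrm 0 = 0.
Hypothesis nrmN : forall x, nrm (- x) = nrm x.
Hypothesis nrmD : forall x y, nrm (x + y) <= nrm x + nrm y.

(** The extension is the infimum of [h y + lam * nrm (x - y)] over [y] in [A]. The Lipschitz bound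
    on [A] keeps it above [h y - lam * nrm (x - y)], so it is finite and equals [h] on [A]. *)
Lemma mcshane_extension (A : set E) (h : E -> R) (lam : R) : 0 <= lam ->
  (forall x y, A x -> A y -> `|h x - h y| <= lam * nrm (x - y)) ->
  exists g, (forall x y, `|g x - g y| <= lam * nrm (x - y)) /\
            (forall x, A x -> g x = h x).
Proof.
move=> lam0 hA.
have nrm_ge0 x : 0 <= nrm x by have := nrmD x (- x); rewrite nrmN subrr nrm0; lra.
have nrmB x y z : nrm (x - z) <= nrm (x - y) + nrm (y - z).
  by apply: le_trans (nrmD _ _); rewrite addrA subrK.
have nrmC x y : nrm (x - y) = nrm (y - x) by rewrite -nrmN opprB.
have [A0|/nonemptyPn A0] := pselect (A !=set0); last first.
  exists (fun=> 0); split=> [x y|x]; last by rewrite A0.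
  by rewrite subrr normr0 mulr_ge0.
case: A0 => a Aa.
pose S x := [set h y + lam * nrm (x - y) | y in A].
have S0 x : S x !=set0 by exists (h a + lam * nrm (x - a)), a.
have lbS x y : A y -> h y - lam * nrm (x - y) <= inf (S x).
  move=> Ay; apply: lb_le_inf => // _ [z Az <-].
  have := hA y z Ay Az; rewrite ler_norml => /andP[_].
  have := ler_wpM2l lam0 (nrmB y x z); rewrite mulrDr (nrmC y x).
  lra.
have infS x y : A y -> inf (S x) <= h y + lam * nrm (x - y).
  move=> Ay; apply: ge_inf; last by exists y.
  exists (h a - lam * nrm (x - a)) => _ [z Az <-].
  have := hA a z Aa Az; rewrite ler_norml => /andP[_].
  have := ler_wpM2l lam0 (nrmB a x z); rewrite mulrDr (nrmC a x).
  lra.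
exists (fun x => inf (S x)); split=> [|x Ax]; last first.
  apply/eqP; rewrite eq_le; apply/andP; split.
    by have := infS x x Ax; rewrite subrr nrm0 mulr0 addr0.
  by have := lbS x x Ax; rewrite subrr nrm0 mulr0 subr0.
suff h1 x y : inf (S x) - lam * nrm (x - y) <= inf (S y).
  by move=> x y; rewrite ler_norml; have := h1 x y; have := h1 y x; rewrite (nrmC y x); lra.
apply: lb_le_inf => // _ [z Az <-].
have := infS x z Az; have := ler_wpM2l lam0 (nrmB x y z); rewrite mulrDr; lra.
Qed.

(** * Sub-Gaussian vectors and finitely many controlled statistics *)

Context {d : measure_display} {T : measurableType d} (P : probability T R).
Variables (Z : T -> E) (C c : R).

Local Notation mean f := (fine 'E_P[fun w => f (Z w)]).

(** The class [E_2] at one pair of dimensions, with [C] and [c] fixed outside so that later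
    constants are uniform in the dimensions. *)
Definition subgaussian := forall f : E -> R, lipschitz1 nrm f ->
  P.-integrable [set: T] (fun w => (f (Z w))%:E) /\
  forall t : R, 0 < t ->
    (P [set w | (t <= `|f (Z w) - mean f|)%R] <=
     (C * expR (- (t / c) ^+ 2))%:E)%E.

Hypothesis Zsub : subgaussian.
Hypotheses (C0 : 0 < C) (c0 : 0 < c).

Lemma subgaussian_lipschitz (g : E -> R) (lam : R) : 0 < lam ->
  (forall x y, `|g x - g y| <= lam * nrm (x - y)) ->
  P.-integrable [set: T] (fun w => (g (Z w))%:E) /\
  forall t : R, 0 < t ->
    (P [set w | (lam * t <= `|g (Z w) - mean g|)%R] <=
     (C * expR (- (t / c) ^+ 2))%:E)%E.
Proof.
move=> lam0 glip.
pose f x := lam^-1 * g x.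
have [|fi ft] := Zsub (f := f).
  by move=> x y; rewrite /f -mulrBr normrM gtr0_norm ?invr_gt0// ler_pdivrMl.
have gf w : g (Z w) = lam * f (Z w) by rewrite /f mulVKf// gt_eqF.
have gfE : (fun w => (g (Z w))%:E) = (fun w => lam%:E * (f (Z w))%:E)%E.
  by apply/funext => w; rewrite gf.
have mE : mean g = lam * mean f.
  rewrite expectation.unlock gfE integralZl// fineM//; exact: integrable_fin_num.
split; first by rewrite gfE; exact: integrableZl.
move=> t t0; apply: le_trans (ft t t0); rewrite mE.
set A := [set w | _]; set B := [set w | _]; suff -> : A = B by [].
apply/seteqP; split=> w; rewrite /A /B/= gf -mulrBr normrM gtr0_norm//;
  by rewrite ler_pM2l.
Qed.

Variables (J : finType) (phi : J -> E -> R) (tau : J -> R) (B : R).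
Hypothesis philip : forall j, lipschitz1 nrm (phi j).
Hypothesis tau0 : forall j, 0 <= tau j.
Hypothesis tauB : \sum_j expR (- (tau j / c) ^+ 2) <= B.

(** The margin [tau j] pays for the union bound over [J], through [tauB]; the level [s] remains
    free. *)
Definition near_mean (s : R) : set E :=
  [set z | forall j, `|phi j z - mean (phi j)| < tau j + s].

Let far_mean (s : R) : set T :=
  [set w | exists j, (tau j + s <= `|phi j (Z w) - mean (phi j)|)%R].

Let measurable_dev (f : E -> R) (t a : R) :
  measurable_fun [set: T] (fun w => f (Z w)) ->
  measurable [set w | (t <= `|f (Z w) - a|)%R].
Proof.
move=> mf; apply: measurable_set_le => //.
by apply: measurableT_comp => //; exact: measurable_funB.
Qed.

Let measurable_lip (f : E -> R) : lipschitz1 nrm f ->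
  measurable_fun [set: T] (fun w => f (Z w)).
Proof. by move=> /Zsub[+ _] => /measurable_int /measurable_EFinP. Qed.

(** As [(tau j + s)^2 >= (tau j)^2 + s^2], each tail splits off a factor
    [expR (- (tau j / c) ^+ 2)], and these sum to at most [B] whatever the size of [J]. *)
Let far_mean_le (s : R) : 0 < s ->
  measurable (far_mean s) /\
  (P (far_mean s) <= (B * C * expR (- (s / c) ^+ 2))%:E)%E.
Proof.
move=> s0.
have [|mfar Pfar] := measure_exists_le P
  (B := fun j => [set w | (tau j + s <= `|phi j (Z w) - mean (phi j)|)%R]).
  by move=> j; apply: measurable_dev; exact: measurable_lip.
split=> //; apply: le_trans Pfar _.
have e0 : 0 <= C * expR (- (s / c) ^+ 2) by rewrite mulr_ge0 ?expR_ge0// ltW.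
apply: (@le_trans _ _ (\sum_j (expR (- (tau j / c) ^+ 2) *
    (C * expR (- (s / c) ^+ 2)))%:E)%E).
  apply: lee_sum => j _.
  have ts : 0 < tau j + s by rewrite ltr_wpDl.
  apply: le_trans ((Zsub (philip j)).2 _ ts) _.
  rewrite lee_fin mulrCA ler_pM2l// -expRD ler_expR -opprD lerN2.
  rewrite mulrDl sqrrD lerD2r lerDl mulrn_wge0//.
  by rewrite mulr_ge0// divr_ge0// ltW.
by rewrite sumEFin lee_fin -mulr_suml -mulrA ler_wpM2r.
Qed.

Let near_meanP s w : near_mean s (Z w) \/ far_mean s w.
Proof.
have [?|nfar] := pselect (far_mean s w); [by right|left=> j].
by rewrite ltNge; apply/negP => h; apply: nfar; exists j.
Qed.

(** * Functions that are Lipschitz where the statistics are near their means *)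

Variables (F : E -> R) (lam : R -> R).
Hypothesis lam0 : forall s, 0 < s -> 0 < lam s.
Hypothesis lam_le : forall s s', 0 < s -> s <= s' -> lam s <= lam s'.
Hypothesis Flip : forall s z z', 0 < s -> near_mean s z -> near_mean s z' ->
  `|F z - F z'| <= lam s * nrm (z - z').

Let extension (s : R) : 0 < s -> exists g : E -> R,
  (forall x y, `|g x - g y| <= lam s * nrm (x - y)) /\
  (forall x, near_mean s x -> g x = F x).
Proof.
move=> s0; apply: mcshane_extension; first by rewrite ltW// lam0.
by move=> x y; exact: Flip.
Qed.

(* [F] is the pointwise limit of Lipschitz functions, whose measurability is
   part of the concentration hypothesis. *)
Let measurable_F : measurable_fun [set: T] (fun w => F (Z w)).
Proof.
have [g gP] := choice (fun k : nat => extension (ltr0Sn R k)).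
apply: (@measurable_fun_cvg _ _ _ _ (fun k w => g k (Z w))).
  move=> k; have [/measurable_int + _] :=
    subgaussian_lipschitz (lam0 (ltr0Sn R k)) (gP k).1.
  by move=> /measurable_EFinP.
move=> w _; apply: (@cvg_near_cst _ R^o).
(* No deviation at [w] exceeds [M], so [g k (Z w) = F (Z w)] as soon as [k >= Num.truncn M]. *)
pose M := \sum_j `|phi j (Z w) - mean (phi j)|.
have M0 : 0 <= M by rewrite sumr_ge0.
exists (Num.truncn M) => // k /= Mk.
apply: (gP k).2 => j.
apply: (@le_lt_trans _ _ M).
  by rewrite /M (bigD1 j)//= lerDl sumr_ge0.
apply: (@lt_le_trans _ _ k.+1%:R); last by rewrite lerDr.
have /truncn_itv/andP[_ h] := M0.
by apply: (lt_le_trans h); rewrite ler_nat ltnS.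
Qed.

Variable s0 : R.
Hypothesis s0_ge1 : 1 <= s0.
Hypothesis s0_small : (B + 1) * C * expR (- (s0 / c) ^+ 2) <= 4^-1.
Hypothesis B0 : 0 <= B.

Let s0_gt0 : 0 < s0. Proof. exact: lt_le_trans ltr01 s0_ge1. Qed.

Let B1_gt0 : 0 < B + 1. Proof. by rewrite ltr_wpDl. Qed.

(* The extensions at levels [s0] and [s] agree with [F] on events of
   probability at least 3/4, which therefore meet; hence their means are
   close. *)
Let deviation_s0 : exists a, forall s, s0 <= s ->
  (P [set w | (3 * (lam s * s) <= `|F (Z w) - a|)%R] <=
   ((B + 1) * C * expR (- (s / c) ^+ 2))%:E)%E.
Proof.
have step s : s0 <= s -> exists (a : R) (N : set T), [/\ measurable N,
    (P N <= ((B + 1) * C * expR (- (s / c) ^+ 2))%:E)%E &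
    forall w, ~ N w -> `|F (Z w) - a| < lam s * s].
  move=> s0s; have sp : 0 < s := lt_le_trans s0_gt0 s0s.
  have [g [glip gF]] := extension sp.
  have [gi gt] := subgaussian_lipschitz (lam0 sp) glip.
  have [mfar Pfar] := far_mean_le sp.
  pose D := [set w | (lam s * s <= `|g (Z w) - mean g|)%R].
  have mD : measurable D.
    by apply: measurable_dev; move/measurable_int: gi => /measurable_EFinP.
  (* Outside this set [g] agrees with [F] and is close to its mean; the two pieces weigh [B * C] and
     [C]. *)
  exists (mean g), (far_mean s `|` D); split.
  - exact: measurableU.
  - apply: le_trans (measureU2 _ _ _) _ => //.
    by rewrite !mulrDl mul1r EFinD leeD// gt.
  - move=> w /not_orP[nfar nD]; have [/gF <-|//] := near_meanP s w.
    by rewrite ltNge; apply/negP.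
have [a [N0 [mN0 PN0 N0P]]] := step _ (lexx s0).
exists a => s s0s.
have [b [N [mN PN NP]]] := step _ s0s.
have sp : 0 < s := lt_le_trans s0_gt0 s0s.
have small : (B + 1) * C * expR (- (s / c) ^+ 2) <= 4^-1.
  apply: le_trans s0_small; rewrite ler_pM2l ?mulr_gt0//.
  have ssc : s0 / c <= s / c by rewrite ler_pM2r ?invr_gt0.
  by rewrite ler_expR lerN2 ler_sqr ?nnegrE ?divr_ge0// ltW.
(* Two events of probability at most 1/4 cannot cover the space. *)
have [w0 w0N] : exists w, ~ (N0 `|` N) w.
  apply: contrapT => /forallNP h.
  have NT : N0 `|` N = [set: T].
    by apply/seteqP; split => // w _; have := h w; rewrite notK.
  have : (P (N0 `|` N) <= (4^-1 + 4^-1)%:E)%E.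
    apply: le_trans (measureU2 _ _ _) _ => //.
    rewrite EFinD leeD//.
      by apply: le_trans PN0 _; rewrite lee_fin.
    by apply: le_trans PN _; rewrite lee_fin.
  by rewrite NT probability_setT lee_fin; lra.
have h0 := N0P w0 (fun h => w0N (or_introl h)).
have h1 := NP w0 (fun h => w0N (or_intror h)).
have lams : lam s0 * s0 <= lam s * s.
  by rewrite ler_pM ?lam_le// ltW// lam0.
apply: le_trans PN; apply: le_measure; rewrite ?inE//.
  by apply: measurable_dev; exact: measurable_F.
(* Going from [F (Z w)] to [b], then to [F (Z w0)], then to [a] takes three steps shorter than
   [lam s * s]: hence the factor 3. *)
move=> w /= hw; apply: contrapT => /NP h2.
move: h0 h1 h2; rewrite !ltr_norml => /andP[? ?] /andP[? ?] /andP[? ?].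
by move: hw; apply/negP; rewrite -ltNge ltr_norml; lra.
Qed.

(** The second summand makes the bound at least 1, hence trivial, below level [s0]. *)
Let C1 := (B + 1) * C + expR ((s0 / c) ^+ 2).

Let deviation : exists a, forall s, 0 < s ->
  (P [set w | (3 * (lam s * s) <= `|F (Z w) - a|)%R] <=
   (C1 * expR (- (s / c) ^+ 2))%:E)%E.
Proof.
have [a ha] := deviation_s0; exists a => s sp.
rewrite /C1 [(_ + _) * expR _]mulrDl; have [s0s|ss0] := leP s0 s.
  apply: le_trans (ha _ s0s) _; rewrite lee_fin lerDl.
  by rewrite mulr_ge0 ?expR_ge0.
apply: (@le_trans _ _ 1%:E).
  by apply: probability_le1; apply: measurable_dev; exact: measurable_F.
rewrite lee_fin -expRD; apply: (@le_trans _ _ (expR ((s0 / c) ^+ 2 - (s / c) ^+ 2))).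
  apply: le_trans (expR_ge1Dx _); rewrite lerDl subr_ge0.
  by rewrite lerXn2r ?nnegrE ?divr_ge0 ?ltW// ltr_pM2r ?invr_gt0.
by rewrite lerDr !mulr_ge0 ?expR_ge0// ltW.
Qed.

Variables (Lam al be : R).
Hypotheses (Lam0 : 0 < Lam) (al1 : 1 <= al) (be1 : 1 <= be).
Hypothesis lamE : forall s, lam s = Lam * ((al + s) * (be + s)).

(** The deviation bound around [a] is a cubic tail in units of [al * be], so the mean lies within
    [O(al * be)] of [a]. The first summand of [K] accounts for the deviation around [a], the second
    for the change of centre. *)
Lemma subgaussian_locally_lipschitz :
  let K := 3 * Lam + 24 * Lam * (1 + 96 * C1 * c ^+ 6) in
  P.-integrable [set: T] (fun w => (F (Z w))%:E) /\
  forall s, 0 < s ->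
  (P [set w | (K * (s * (al + s) * (be + s)) <= `|F (Z w) - mean F|)%R] <=
   (C1 * expR (- (s / c) ^+ 2))%:E)%E.
Proof.
have [a ha] := deviation.
have [Lam_gt0 al_ge1 be_ge1 s0ge1] := And4 Lam0 al1 be1 s0_ge1.
have C1p : 0 < C1 by rewrite ltr_wpDl ?expR_gt0// mulr_ge0// ltW.
pose V w := `|F (Z w) - a|.
have mFa : measurable_fun [set: T] (fun w => F (Z w) - a).
  exact: measurable_funB.
have mV : measurable_fun [set: T] V by exact: measurableT_comp.
(* For [k >= 1], [al + k <= 2 al k] and [be + k <= 2 be k], so [3 * (lam k * k) <= b k^3]. *)
pose b := 12 * Lam * (al * be).
have b0 : 0 < b by rewrite !mulr_gt0//; lra.
have intV : (\int[P]_w (V w)%:E <= (b * (2 * (1 + 96 * C1 * c ^+ 6)))%:E)%E.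
  have V0 w : 0 <= V w by rewrite /V.
  apply: (integral_cubic_tail mV V0 b0 C1p c0) => k k0.
  have k1 : 1 <= k%:R :> R by rewrite ler1n.
  apply: le_trans (ha k%:R _); last by lra.
  apply: le_measure; rewrite ?inE.
  - exact: measurable_set_le.
  - by apply: measurable_dev; exact: measurable_F.
  - move=> w /=; apply: le_trans; rewrite lamE /b.
    move: (k%:R : R) k1 => x x1.
    have h1 : al + x <= 2 * (al * x) by nra.
    have h2 : be + x <= 2 * (be * x) by nra.
    have : (al + x) * (be + x) <= 2 * (al * x) * (2 * (be * x)).
      by rewrite ler_pM//; lra.
    have Lx : 0 <= 3 * Lam * x by rewrite !mulr_ge0//; lra.
    by move=> /(ler_wpM2l Lx); lra.
have iFa : P.-integrable [set: T] (fun w => (F (Z w) - a)%:E).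
  apply/integrableP; split; first exact/measurable_EFinP.
  by apply: le_lt_trans intV _; rewrite ltry.
have icst : P.-integrable [set: T] (EFin \o cst a).
  exact: finite_measure_integrable_cst.
have iF : P.-integrable [set: T] (fun w => (F (Z w))%:E).
  have := integrableD measurableT iFa icst.
  by congr (_.-integrable _ _); apply/funext => w /=; rewrite -EFinD subrK.
have mean_a : `|mean F - a| <= 2 * b * (1 + 96 * C1 * c ^+ 6).
  have -> : mean F - a = fine (\int[P]_w (F (Z w) - a)%:E)%E.
    rewrite expectation.unlock.
    under [in RHS]eq_integral do rewrite EFinB.
    have int_cst : (\int[P]_w (cst a w)%:E = a%:E)%E.
      transitivity (a%:E * P [set: T])%E; last by rewrite probability_setT mule1.
      exact: (integral_cst P measurableT a%:E).
    rewrite (integralB_EFin measurableT iF icst) int_cst.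
    symmetry; apply: (@fineB _ _ a%:E) => //.
    exact: (integrable_fin_num measurableT iF).
  rewrite -lee_fin -[leLHS]/(`|_|%:E) -fine_abse; last exact: (integrable_fin_num measurableT iFa).
  rewrite fineK; last by rewrite abse_fin_num; exact: (integrable_fin_num measurableT iFa).
  apply: le_trans (le_abse_integral _ _ _) _ => //; first exact/measurable_EFinP.
  by apply: le_trans intV _; rewrite lee_fin; lra.
move=> K; split=> // s sp.
set Q := expR _.
(* Below 1, hence below [s0], the bound is trivial; from 1 on, [al * be <= s * (al + s) * (be + s)]
   absorbs the change of centre. *)
have [s1|s1] := leP 1 s; last first.
  apply: (@le_trans _ _ 1%:E).
    by apply: probability_le1; apply: measurable_dev; exact: measurable_F.
  rewrite lee_fin /C1 mulrDl.
  have : 1 <= expR ((s0 / c) ^+ 2) * Q.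
    rewrite -expRD; apply: le_trans (expR_ge1Dx _); rewrite lerDl subr_ge0.
    by rewrite lerXn2r ?nnegrE ?divr_ge0 ?ltW// ltr_pM2r ?invr_gt0//; lra.
  have : 0 <= (B + 1) * C * Q by rewrite !mulr_ge0 ?expR_ge0// ltW.
  lra.
apply: le_trans (ha s sp); apply: le_measure; rewrite ?inE.
- by apply: measurable_dev; exact: measurable_F.
- by apply: measurable_dev; exact: measurable_F.
move=> w /= h; rewrite lamE.
have tri : `|F (Z w) - mean F| <= `|F (Z w) - a| + `|mean F - a|.
  by rewrite (distrC (mean F)); exact: ler_distD.
have ab : al * be <= s * (al + s) * (be + s).
  have : al * be <= (al + s) * (be + s) by rewrite ler_pM//; lra.
  have : 0 <= (al + s) * (be + s) by rewrite mulr_ge0//; lra.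
  by nra.
have X0 : 0 <= 24 * Lam * (1 + 96 * C1 * c ^+ 6).
  by rewrite !mulr_ge0 ?addr_ge0 ?mulr_ge0 ?exprn_ge0// ltW.
have := ler_wpM2l X0 ab.
by move: h mean_a; rewrite /K /b; lra.
Qed.

End Seminorm.

(** * From powers of the level to the three tails *)

Section TailConversion.
Context {R : realType} {d : measure_display} {T : measurableType d}.
Variable P : probability T R.

Lemma ln_le_id (x : R) : 0 < x -> ln x <= x.
Proof. by move=> x0; have := @le_ln1Dx R (x - 1); rewrite [1 + _]addrC subrK; lra. Qed.

(** Use [ln (1 + x) <= x] at [x = -1/2]. This later compares [1 + ln (n p)] with [ln (n p)] when
    [n p >= 2]. *)
Lemma ln2_ge : 2^-1 <= ln 2 :> R.
Proof.
have := @le_ln1Dx R (- 2^-1).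
rewrite (_ : 1 + - 2^-1 = 2^-1); last by field.
by rewrite lnV ?posrE//; lra.
Qed.

(** With [s = c m] the product has terms in [m], [m^2], [m^3], and [al + be <= 3 al]. Each of [r1],
    [sqrt r2], [r3^(1/3)] keeps one term within its share of [t]; the coefficients in [k] make the
    shares add up to [t]. *)
Lemma three_scale_tail (V : T -> R) (K C c al be t : R) :
  measurable_fun [set: T] V -> 0 < K -> 0 < C -> 0 < c -> 0 < al -> 0 < be ->
  be <= 2 * al ->
  (forall s, 0 < s -> (P [set w | (K * (s * (al + s) * (be + s)) <= V w)%R] <=
     (C * expR (- (s / c) ^+ 2))%:E)%E) ->
  let k := K * (c + 3 * c ^+ 2 + c ^+ 3) in
  0 < t ->
  (P [set w | (t <= V w)%R] <= (C * (expR (- (t / (k * (al * be))) ^+ 2) +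
     expR (- (t / (k * al))) + expR (- ((t / k) `^ (2 / 3)))))%:E)%E.
Proof.
move=> mV K0 C0 c0 al0 be0 beal PV k t0.
have k0 : 0 < k by rewrite mulr_gt0// !addr_gt0// ?mulr_gt0// exprn_gt0.
set r1 := t / (k * (al * be)); set r2 := t / (k * al); set r3 := t / k.
have r10 : 0 < r1 by rewrite divr_gt0// mulr_gt0// mulr_gt0.
have r20 : 0 < r2 by rewrite divr_gt0// mulr_gt0.
have r30 : 0 < r3 by rewrite divr_gt0.
have s20 : 0 < Num.sqrt r2 by rewrite sqrtr_gt0.
have s30 : 0 < r3 `^ 3^-1 by rewrite powR_gt0.
(* The level [s = c m] balances the three terms of [K s (al + s) (be + s)]. *)
pose m := Num.min (Num.min r1 (Num.sqrt r2)) (r3 `^ 3^-1).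
have m0 : 0 < m by rewrite !lt_min r10 s20 s30.
have m1 : m <= r1 by rewrite /m !ge_min lexx.
have m2 : m ^+ 2 <= r2.
  rewrite -[leRHS](sqr_sqrtr (ltW r20)) ler_sqr ?nnegrE ?(ltW m0) ?(ltW s20)//.
  by rewrite /m !ge_min lexx orbT.
have cube : (r3 `^ 3^-1) ^+ 3 = r3.
  rewrite -powR_mulrn ?powR_ge0// -powRrM mulVf ?pnatr_eq0// powRr1//; exact: ltW.
have square : (r3 `^ 3^-1) ^+ 2 = r3 `^ (2 / 3).
  by rewrite -powR_mulrn ?powR_ge0// -powRrM mulrC.
have m3 : m ^+ 3 <= r3.
  rewrite -[leRHS]cube; apply: lerXn2r; rewrite ?nnegrE ?powR_ge0 ?(ltW m0)//.
  by rewrite /m !ge_min lexx orbT.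
have cm0 : 0 < c * m by rewrite mulr_gt0.
have mt : K * (c * m * (al + c * m) * (be + c * m)) <= t.
  have -> : K * (c * m * (al + c * m) * (be + c * m)) =
      K * (c * (al * be) * m + c ^+ 2 * ((al + be) * m ^+ 2) + c ^+ 3 * m ^+ 3).
    by ring.
  have -> : t = K * (c * (al * be) * r1 + c ^+ 2 * (3 * al * r2) + c ^+ 3 * r3).
    have cancel (x y : R) : 0 < x -> 0 < y -> x * (t / (y * x)) = t / y.
      by move=> x0 y0; field; rewrite !gt_eqF.
    have -> : c * (al * be) * r1 = c * r3.
      by rewrite -mulrA cancel// mulr_gt0.
    have -> : 3 * al * r2 = 3 * r3 by rewrite -mulrA cancel.
    transitivity (k * r3); first by rewrite /r3 mulrC divfK// gt_eqF.
    by rewrite /k; ring.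
  rewrite ler_pM2l// !lerD//.
  - by rewrite ler_pM2l// !mulr_gt0.
  - rewrite ler_pM2l ?exprn_gt0// ler_pM ?addr_ge0 ?sqr_ge0 ?(ltW al0) ?(ltW be0)//.
    by lra.
  - by rewrite ler_pM2l ?exprn_gt0.
apply: (@le_trans _ _ (P [set w | (K * (c * m * (al + c * m) * (be + c * m)) <= V w)%R])).
  apply: le_measure; rewrite ?inE; [exact: measurable_set_le..|].
  by move=> w /=; exact: le_trans.
apply: le_trans (PV _ cm0) _.
rewrite lee_fin ler_pM2l// [c * m]mulrC mulfK ?gt_eqF//.
have e1 := expR_ge0 (- r1 ^+ 2); have e2 := expR_ge0 (- r2).
have e3 := expR_ge0 (- (r3 `^ (2 / 3))).
(* Whichever value attains the minimum, [expR (- m ^+ 2)] is exactly the corresponding tail. *)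
rewrite /m; case: (leP (Num.min r1 (Num.sqrt r2)) (r3 `^ 3^-1)) => _.
  case: (leP r1 (Num.sqrt r2)) => _; first lra.
  by rewrite sqr_sqrtr ?(ltW r20)//; lra.
by rewrite square; lra.
Qed.

Lemma exp_tail_le (q sigma c r t : R) : 0 < t -> 0 < q -> 0 < c -> 0 < sigma ->
  t / (c * sigma) <= r -> expR (- (r `^ q)) <= exp_tail c q sigma t.
Proof.
move=> t0 q0 c0 sigma0 tr; rewrite /exp_tail gt_eqF; last by [].
rewrite ler_expR lerN2.
have tc : 0 <= t / (c * sigma) by rewrite divr_ge0 ?mulr_ge0// ltW.
by rewrite ge0_ler_powR ?nnegrE ?(ltW q0)//; exact: le_trans tr.
Qed.

(** The target scale has [ln (n p)] where [be] has [1 + ln (n p)]. For [n p >= 2],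
    [be ^+ 2 <= 4 ln (n p)] costs a factor 2 in the scale. For [n p = 1] that scale is 0 and its
    tail is 0 by convention; the Gaussian term then goes into the [E_1] tail by
    [expR (- r ^+ 2) <= expR 1 * expR (- r)], whence [1 + expR 1]. *)
Lemma concentration_tail (V : T -> R) (K C c t : R) (p n : nat) :
  let al : R := Num.sqrt (p + n)%:R in
  let be : R := Num.sqrt (1 + ln (n * p)%:R) in
  (0 < p)%N -> (0 < n)%N -> measurable_fun [set: T] V ->
  0 < K -> 0 < C -> 0 < c ->
  (forall s, 0 < s -> (P [set w | (K * (s * (al + s) * (be + s)) <= V w)%R] <=
     (C * expR (- (s / c) ^+ 2))%:E)%E) ->
  0 < t ->
  (P [set w | (t <= V w)%R] <= (C * (1 + expR 1) *
     \sum_(l <- [:: (2, Num.sqrt ((p + n)%:R * ln (n * p)%:R));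
                    (1, al); (2 / 3, 1)])
       exp_tail (2 * (K * (c + 3 * c ^+ 2 + c ^+ 3))) l.1 l.2 t)%:E)%E.
Proof.
move=> al be p0 n0 mV K0 C0 c0 PV t0.
have k0 : 0 < K * (c + 3 * c ^+ 2 + c ^+ 3).
  by rewrite mulr_gt0// !addr_gt0// ?mulr_gt0// exprn_gt0.
have np1 : 1 <= (n * p)%:R :> R by rewrite ler1n muln_gt0 n0.
have ln0 : 0 <= ln (n * p)%:R :> R by rewrite ln_ge0.
have N0 : 0 < (p + n)%:R :> R by rewrite ltr0n addn_gt0 p0.
have al0 : 0 < al by rewrite sqrtr_gt0.
have be0 : 0 < be by rewrite sqrtr_gt0; lra.
have al2 : al ^+ 2 = (p + n)%:R by rewrite sqr_sqrtr// ltW.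
have be2 : be ^+ 2 = 1 + ln (n * p)%:R by rewrite sqr_sqrtr//; lra.
have be1 : (n * p <= 1)%N -> be = 1.
  move=> np; have np1' : (n * p)%N = 1%N by apply/eqP; rewrite eqn_leq np muln_gt0 n0 p0.
  by rewrite /be np1' ln1 addr0 sqrtr1.
clearbody al be.
(* After squaring, [1 + ln n + ln p <= 4 (p + n)] follows from [ln x <= x]. *)
have beal : be <= 2 * al.
  rewrite -ler_sqr ?nnegrE ?mulr_ge0 ?(ltW al0) ?(ltW be0)//.
  rewrite exprMn al2 be2 natrM natrD.
  have p1 : 1 <= p%:R :> R by rewrite ler1n.
  have n1 : 1 <= n%:R :> R by rewrite ler1n.
  rewrite lnM ?posrE ?ltr0n//.
  have := @ln_le_id p%:R; have := @ln_le_id n%:R; lra.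
apply: le_trans (three_scale_tail mV K0 C0 c0 al0 be0 beal PV t0) _.
move: (K * _) k0 => k k0.
have e1 : 1 <= expR 1 :> R by have := @expR_ge1Dx R 1; lra.
have sqr_exp r : expR (- r ^+ 2) <= expR 1 * expR (- r) :> R.
  rewrite -expRD ler_expR.
  by have := sqr_ge0 (r - 1); have := sqr_ge0 r; rewrite sqrrB; lra.
move: (expR 1) e1 sqr_exp => e e1 sqr_exp.
rewrite lee_fin -[leRHS]mulrA (ler_pM2l C0).
rewrite !big_cons big_nil /fst /snd.
set E2 := exp_tail _ 2 _ _; set E1 := exp_tail _ 1 _ _.
set E3 := exp_tail _ (2 / 3) _ _.
have tk a : 0 < a -> t / (2 * k * a) <= t / (k * a).
  move=> a0; rewrite ler_pM2l// lef_pV2 ?posrE ?mulr_gt0//.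
  by rewrite ler_pM2r//; lra.
have h3 : expR (- ((t / k) `^ (2 / 3))) <= E3.
  apply: exp_tail_le; rewrite ?mulr_gt0 ?invr_gt0//.
  by have := tk 1 ltr01; rewrite !mulr1.
have h1 : expR (- (t / (k * al))) <= E1.
  rewrite -[t / (k * al)]powRr1; last by rewrite divr_ge0 ?mulr_ge0// ltW.
  by apply: exp_tail_le; rewrite ?mulr_gt0//; exact: tk.
have E20 : 0 <= E2.
  by rewrite /E2 /exp_tail; case: ifP => // _; exact: expR_ge0.
have h10 := le_trans (expR_ge0 _) h1.
have h30 := le_trans (expR_ge0 _) h3.
have e0 : 0 < e by lra.
have h2 : expR (- (t / (k * (al * be))) ^+ 2) <= E2 + e * E1.
  have [np|np] := ltnP 1 (n * p).
  - have ln_ge : 2^-1 <= ln (n * p)%:R :> R.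
      apply: le_trans ln2_ge _; rewrite ler_ln ?posrE ?ltr0n ?(ltnW np)//.
      by rewrite ler_nat.
    have lnp : 0 < ln (n * p)%:R :> R by lra.
    have sigma0 : 0 < Num.sqrt ((p + n)%:R * ln (n * p)%:R) :> R.
      by rewrite sqrtr_gt0 (mulr_gt0 N0 lnp).
    rewrite -[leLHS]addr0; apply: lerD; last exact: mulr_ge0 (ltW e0) h10.
    rewrite -powR_mulrn; last by rewrite divr_ge0 ?mulr_ge0// ltW.
    apply: exp_tail_le; rewrite ?mulr_gt0//.
    rewrite ler_pM2l// lef_pV2 ?posrE ?mulr_gt0//.
    rewrite [2 * k]mulrC -mulrA ler_pM2l//.
    rewrite -ler_sqr ?nnegrE ?mulr_ge0 ?(ltW al0) ?(ltW be0) ?(ltW sigma0)//.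
    rewrite !exprMn al2 be2 sqr_sqrtr; last by rewrite mulr_ge0 ?(ltW N0).
    by rewrite mulrCA (ler_pM2l N0); lra.
  - rewrite (be1 np) mulr1 -[leLHS]add0r; apply: (lerD E20).
    exact: le_trans (sqr_exp _) (ler_wpM2l (ltW e0) h1).
have := ler_wpM2r E20 e1; have := ler_wpM2r h30 e1; have := ler_wpM2r h10 e1; lra.
Qed.

End TailConversion.

(** * The product [X D Y^T u] *)

(** Factors are replaced one at a time, so primed ones stand to the left of each difference and
    unprimed ones to the right. *)
Lemma mulmx4B (R : realType) p n (A A' : 'M[R]_(p, n)) (D D' : 'M[R]_n)
    (B B' : 'M[R]_(n, p)) (u : 'cV[R]_p) :
  A *m D *m B *m u - A' *m D' *m B' *m u =
  (A - A') *m (D *m (B *m u)) + A' *m ((D - D') *m (B *m u))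
  + A' *m (D' *m ((B - B') *m u)).
Proof. by rewrite !mulmxBl !mulmxBr !mulmxA !addrA !subrK. Qed.

Section ProductMap.
Context {R : realType}.
Variables p n : nat.

Definition triple : lmodType R := ('M[R]_(p, n) * 'M[R]_(p, n) * diagmx R n)%type.

Lemma prodnorm0 : prodnorm (0 : triple) = 0.
Proof. by rewrite /prodnorm/= !frobnorm0 !maxxx. Qed.

Lemma prodnormN (z : triple) : prodnorm (- z) = prodnorm z.
Proof. by rewrite /prodnorm/= !frobnormN. Qed.

Lemma prodnormD (z z' : triple) : prodnorm (z + z') <= prodnorm z + prodnorm z'.
Proof.
rewrite /prodnorm !ge_max/= -!andbA; apply/and3P; split.
- by apply: le_trans (frobnormD _ _) _; rewrite lerD// !le_max lexx.
- by apply: le_trans (frobnormD _ _) _; rewrite lerD// !le_max lexx ?orbT.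
- by apply: le_trans (frobnormD _ _) _; rewrite lerD// !le_max lexx ?orbT.
Qed.

Lemma frobnorm_prodnorm (z : triple) : [/\ frobnorm z.1.1 <= prodnorm z,
  frobnorm z.1.2 <= prodnorm z & frobnorm z.2 <= prodnorm z].
Proof. by rewrite /prodnorm !le_max !lexx !orbT. Qed.

Variable u : 'cV[R]_p.
Hypothesis u_le1 : enorm u <= 1.

Definition product_map (z : triple) : 'cV[R]_p :=
  z.1.1 *m z.2 *m z.1.2^T *m u.

Definition statistics_index : finType :=
  (net p * net n + net p * net n + ('I_n + 'I_n))%type.

(* The linear statistics of [(X, Y, D)] that control [|X|], [|Y|], the
   diagonal of [D] and the coordinates of [Y^T u]. *)
Definition statistic (j : statistics_index) (z : triple) : R :=
  match j with
  | inl (inl k) => bilin z.1.1 (net_point R k.1) (net_point R k.2)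
  | inl (inr k) => bilin z.1.2 (net_point R k.1) (net_point R k.2)
  | inr (inl i) => (z.2 : 'M[R]_n) i i
  | inr (inr i) => bilin z.1.2 u (delta_mx i ord0)
  end.

Lemma statistic_lipschitz j : lipschitz1 (@prodnorm R p n) (statistic j).
Proof.
move=> x y; have [h1 h2 h3] := frobnorm_prodnorm (x - y).
case: j => [[k|k]|[i|i]] /=.
- rewrite -bilin_subM; apply: le_trans h1.
  exact: ler_bilin_frobnorm (enorm_net_point _ _) (enorm_net_point _ _).
- rewrite -bilin_subM; apply: le_trans h2.
  exact: ler_bilin_frobnorm (enorm_net_point _ _) (enorm_net_point _ _).
- apply: le_trans h3.
  have -> : (x.2 : 'M[R]_n) i i - (y.2 : 'M[R]_n) i i = ((x - y).2 : 'M[R]_n) i i.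
    by rewrite !mxE.
  exact: ler_frobnorm.
- rewrite -bilin_subM; apply: le_trans h2.
  by apply: ler_bilin_frobnorm => //; rewrite enorm_delta.
Qed.

(** Each term of [mulmx4B] is at most [a * b * prodnorm (z - z')]: the differing factor is measured
    in Frobenius norm, one other quantity by [a], one by [b]. The asymmetric hypotheses reflect the
    order of replacement. *)
Lemma product_map_lipschitz (a b : R) (z z' : triple) : 0 <= a -> 0 <= b ->
  (forall x, enorm (z'.1.1 *m x) <= a * enorm x) ->
  enorm (z.1.2^T *m u) <= a ->
  (forall i, `|(z.2 : 'M[R]_n) i i| <= b) ->
  (forall i, `|(z'.2 : 'M[R]_n) i i| <= b) ->
  (forall i, `|(z.1.2^T *m u) i ord0| <= b) ->
  enorm (product_map z - product_map z') <= 3 * (a * b) * prodnorm (z - z').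
Proof.
move=> a0 b0 X'a Ya Db D'b Yb.
have [hX hY hD] := frobnorm_prodnorm (z - z').
set N := prodnorm _ in hX hY hD *.
have N0 : 0 <= N by apply: le_trans hX; exact: frobnorm_ge0.
have [diagD diagD'] : is_diag_mx (z.2 : 'M[R]_n) /\ is_diag_mx (z'.2 : 'M[R]_n).
  by split; exact: valP.
have diagB : is_diag_mx ((z - z').2 : 'M[R]_n) by exact: valP.
pose y := z.1.2^T *m u.
have -> : product_map z - product_map z' =
    (z - z').1.1 *m (z.2 *m y) + z'.1.1 *m ((z - z').2 *m y)
    + z'.1.1 *m (z'.2 *m ((z - z').1.2^T *m u)).
  have -> : (z - z').1.2^T = z.1.2^T - z'.1.2^T by rewrite linearB.
  exact: mulmx4B.
have h1 : enorm ((z - z').1.1 *m (z.2 *m y)) <= a * b * N.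
  apply: le_trans (enorm_mulmx _ _) _.
  rewrite mulrC ler_pM ?enorm_ge0 ?frobnorm_ge0//.
  apply: le_trans (enorm_diag_mulmx _ diagD b0 Db) _.
  by rewrite mulrC ler_wpM2r.
have h2 : enorm (z'.1.1 *m ((z - z').2 *m y)) <= a * b * N.
  apply: le_trans (X'a _) _; rewrite -mulrA ler_wpM2l//.
  apply: le_trans (enorm_mulmx_diag diagB b0 Yb) _.
  by rewrite mulrC ler_wpM2l.
have h3 : enorm (z'.1.1 *m (z'.2 *m ((z - z').1.2^T *m u))) <= a * b * N.
  apply: le_trans (X'a _) _; rewrite -mulrA ler_wpM2l//.
  apply: le_trans (enorm_diag_mulmx _ diagD' b0 D'b) _; rewrite ler_wpM2l//.
  apply: le_trans (enorm_mulmx _ _) _; rewrite frobnorm_tr -[leRHS]mulr1.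
  by rewrite ler_pM ?enorm_ge0 ?frobnorm_ge0.
apply: le_trans (enormD _ _) _.
have := enormD ((z - z').1.1 *m (z.2 *m y)) (z'.1.1 *m ((z - z').2 *m y)).
lra.
Qed.

End ProductMap.

(** * Means of bilinear statistics and the cost of the union bound *)

Section Means.
Context {R : realType} {d : measure_display} {T : measurableType d}.
Variable P : probability T R.

Lemma mean_bilin p n (M : T -> 'M[R]_(p, n)) v x :
  (forall i j, P.-integrable [set: T] (fun w => (M w i j)%:E)) ->
  fine 'E_P[fun w => bilin (M w) v x] = bilin (mean_matrix P M) v x.
Proof.
move=> iM.
pose a (ij : 'I_p * 'I_n) := v ij.1 ord0 * x ij.2 ord0.
have bilin_pair (A : 'M[R]_(p, n)) :
    bilin A v x = \sum_ij a ij * A ij.1 ij.2.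
  by rewrite /bilin pair_bigA; apply: eq_bigr => ij _; rewrite /a/=; ring.
have mM i j : ('E_P[fun w => M w i j] = (mean_matrix P M i j)%:E)%E.
  rewrite mxE fineK// expectation.unlock; exact: (integrable_fin_num measurableT (iM i j)).
rewrite bilin_pair expectation.unlock.
have -> : (\int[P]_w (bilin (M w) v x)%:E =
    \int[P]_w (\sum_ij (a ij)%:E * (M w ij.1 ij.2)%:E))%E.
  by apply: eq_integral => w _; rewrite bilin_pair -sumEFin.
rewrite integral_sum//; last by move=> ij; exact: integrableZl.
have -> : (\sum_ij \int[P]_w ((a ij)%:E * (M w ij.1 ij.2)%:E) =
    \sum_ij (a ij * mean_matrix P M ij.1 ij.2)%:E)%E.
  apply: eq_bigr => ij _; rewrite integralZl//.
  rewrite [RHS]EFinM; congr (_ * _)%E.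
  by have := mM ij.1 ij.2; rewrite expectation.unlock.
by rewrite sumEFin.
Qed.

End Means.

(** The margin [5 c] gives exponents [25 (p + n)] and [25 (1 + ln (n p))]. The first beats the at
    most [2 ^ (18 (p + n))] pairs of net points, as [2 <= expR 1]; the second beats [n] coordinates.
    Each of the four families contributes at most 1. *)
Lemma sum_statistics (R : realType) (c : R) (p n : nat) :
  let al : R := Num.sqrt (p + n)%:R in
  let be : R := Num.sqrt (1 + ln (n * p)%:R) in
  (0 < p)%N -> (0 < n)%N -> 0 < c ->
  \sum_(j : statistics_index p n)
    expR (- ((5 * c * if j is inl _ then al else be) / c) ^+ 2) <= 4.
Proof.
move=> al be p0 n0 c0.
have c_neq0 : c != 0 by rewrite gt_eqF.
have scale a : (5 * c * a / c) ^+ 2 = 25 * a ^+ 2.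
  by have -> : 5 * c * a / c = 5 * a; [field|rewrite exprMn -natrX].
have al2 : al ^+ 2 = (p + n)%:R by rewrite sqr_sqrtr.
have np1 : 1 <= (n * p)%:R :> R by rewrite ler1n muln_gt0 n0.
have ln0 : 0 <= ln (n * p)%:R :> R by rewrite ln_ge0.
have be2 : be ^+ 2 = 1 + ln (n * p)%:R by rewrite sqr_sqrtr// addr_ge0.
have two_le : 2 <= expR 1 :> R by have := @expR_ge1Dx R 1; lra.
have net_part : \sum_(k : (net p * net n)%type) expR (- (5 * c * al / c) ^+ 2) <= 1.
  rewrite sumr_const card_prod -[_ *+ _]mulr_natl natrM.
  apply: (@le_trans _ _ (2 ^+ (18 * p) * 2 ^+ (18 * n) * expR (- (5 * c * al / c) ^+ 2))).
    by rewrite ler_wpM2r ?expR_ge0// ler_pM// card_net.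
  rewrite -exprD -mulnDr.
  apply: (@le_trans _ _ (expR 1 ^+ (18 * (p + n)) * expR (- (5 * c * al / c) ^+ 2))).
    rewrite ler_wpM2r ?expR_ge0//; apply: lerXn2r => //.
      by rewrite nnegrE ler0n.
    by rewrite nnegrE expR_ge0.
  rewrite -expRM_natl -expRD mulr1 -[leRHS]expR0 ler_expR scale al2 natrM.
  have : 0 <= (p + n)%:R :> R by [].
  lra.
have coord_part : \sum_(i < n) expR (- (5 * c * be / c) ^+ 2) <= 1.
  rewrite sumr_const card_ord -[_ *+ _]mulr_natl scale be2.
  have n1 : 0 < n%:R :> R by rewrite ltr0n.
  apply: (@le_trans _ _ (n%:R * expR (- ln n%:R))).
    rewrite ler_pM2l// ler_expR lerN2.
    have : ln n%:R <= ln (n * p)%:R :> R.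
      rewrite ler_ln ?posrE ?ltr0n ?muln_gt0 ?n0//.
      by rewrite ler_nat leq_pmulr.
    lra.
  by rewrite expRN lnK ?posrE// mulfV// gt_eqF.
rewrite !big_sumType/=; lra.
Qed.

(** [K] and [C'] are chosen before the probability space and the dimensions: this is the uniformity
    that the conclusion demands. *)
Lemma product_deviation (R : realType) (C c Cx Cd Cy : R) :
  0 < C -> 0 < c -> 0 < Cx -> 0 < Cd -> 0 < Cy ->
  exists K C' : R, [/\ 0 < K, 0 < C' &
  forall (d : measure_display) (T : measurableType d) (P : probability T R)
    (p n : nat) (X Y : T -> 'M[R]_(p, n)) (D : T -> diagmx R n)
    (u : 'cV[R]_p) (f : 'cV[R]_p -> R),
  let al : R := Num.sqrt (p + n)%:R in
  let be : R := Num.sqrt (1 + ln (n * p)%:R) in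
  let V w := X w *m D w *m (Y w)^T *m u in
  (0 < p)%N -> (0 < n)%N ->
  @subgaussian R (triple p n) (@prodnorm R p n) d T P
    (fun w => (X w, Y w, D w)) C c ->
  specnorm (mean_matrix P X) <= Cx * al ->
  specnorm (mean_matrix P (fun w => D w : 'M[R]_n)) <= Cd ->
  (forall i, enorm (col i (mean_matrix P Y)) <= Cy) ->
  enorm u <= 1 -> lipschitz1 (@enorm R p) f ->
  P.-integrable [set: T] (fun w => (f (V w))%:E) /\
  forall s, 0 < s ->
    (P [set w | (K * (s * (al + s) * (be + s)) <=
                 `|f (V w) - fine 'E_P[fun w' => f (V w')]|)%R] <=
     (C' * expR (- (s / c) ^+ 2))%:E)%E].
Proof.
move=> C0 c0 Cx0 Cd0 Cy0.
(* [10 * c] is the margin [5 * c] doubled by the net, 2 comes from the doubled level, and [Cx],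
   [Cd], [Cy] bound the means. *)
pose kap := 10 * c + Cx + Cd + Cy + 2.
have kap0 : 0 < kap by rewrite /kap; lra.
pose Lam := 3 * kap ^+ 2.
have Lam0 : 0 < Lam by rewrite mulr_gt0// exprn_gt0.
(* This makes [(s0 / c) ^+ 2 >= 20 * C], so [1 + x <= expR x] gives the required smallness with
   [B = 4]. *)
pose s0 := 1 + c * (20 * C + 1).
have s0_ge1 : 1 <= s0 by rewrite lerDl mulr_ge0//; lra.
have s0_small : (4 + 1) * C * expR (- (s0 / c) ^+ 2) <= 4^-1.
  have h : 20 * C + 1 <= s0 / c.
    rewrite ler_pdivlMr// /s0; lra.
  have h2 : 20 * C <= (s0 / c) ^+ 2 by nra.
  rewrite expRN ler_pdivrMr ?expR_gt0//.
  by have := @expR_ge1Dx R ((s0 / c) ^+ 2); lra.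
pose C1 := (4 + 1) * C + expR ((s0 / c) ^+ 2).
have C10 : 0 < C1.
  by have := expR_gt0 ((s0 / c) ^+ 2); rewrite /C1; lra.
pose K := 3 * Lam + 24 * Lam * (1 + 96 * C1 * c ^+ 6).
have K0 : 0 < K.
  have h : 0 < 96 * C1 * c ^+ 6 by rewrite (mulr_gt0 (mulr_gt0 _ C10)) ?exprn_gt0.
  have : 0 <= 24 * Lam * (1 + 96 * C1 * c ^+ 6) by rewrite mulr_ge0//; lra.
  by rewrite /K; lra.
exists K, C1; split=> // d T P p n X Y D u f al be V p0 n0 Zsub EX ED EY u1 flip.
have N1 : 1 <= (p + n)%:R :> R by rewrite ler1n addn_gt0 p0.
have al1 : 1 <= al by rewrite -sqrtr1 ler_wsqrtr.
have np1 : 1 <= (n * p)%:R :> R by rewrite ler1n muln_gt0 n0.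
have be1 : 1 <= be.
  by rewrite -[leLHS]sqrtr1 ler_wsqrtr// lerDl ln_ge0.
have al2 : al ^+ 2 = (p + n)%:R by rewrite sqr_sqrtr.
pose Z w : triple p n := (X w, Y w, D w).
pose tau (j : statistics_index p n) := 5 * c * if j is inl _ then al else be.
have tauB : \sum_j expR (- (tau j / c) ^+ 2) <= 4 := sum_statistics p0 n0 c0.
clearbody al be; clear N1 np1.
have [al0 be0] : 0 <= al /\ 0 <= be by split; lra.
have tau0 j : 0 <= tau j by rewrite /tau; case: j => _; rewrite mulr_ge0//; lra.
have entry (g : triple p n -> R) : lipschitz1 (@prodnorm R p n) g ->
    P.-integrable [set: T] (fun w => (g (Z w))%:E).
  by move=> /Zsub[].
have iX i j : P.-integrable [set: T] (fun w => (X w i j)%:E).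
  apply: (entry (fun z => z.1.1 i j)) => x y.
  have [h _ _] := frobnorm_prodnorm (x - y); apply: le_trans h.
  by apply: le_trans (ler_frobnorm _ i j); rewrite !mxE.
have iY i j : P.-integrable [set: T] (fun w => (Y w i j)%:E).
  apply: (entry (fun z => z.1.2 i j)) => x y.
  have [_ h _] := frobnorm_prodnorm (x - y); apply: le_trans h.
  by apply: le_trans (ler_frobnorm _ i j); rewrite !mxE.
pose mX := mean_matrix P X; pose mY := mean_matrix P Y.
pose mD := mean_matrix P (fun w => D w : 'M[R]_n).
have coordY (A : 'M[R]_(p, n)) i : bilin A u (delta_mx i ord0) = (A^T *m u) i ord0.
  rewrite -bilin_tr bilinE (bigD1 i)//= big1 ?addr0 ?mxE ?eqxx ?mul1r// => j /negbTE ji.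
  by rewrite mxE ji mul0r.
(* This coordinate is the inner product of [E[y_i]] and [u], so its bound is independent of the
   dimensions. *)
have mYu i : `|(mY^T *m u) i ord0| <= Cy.
  have -> : (mY^T *m u) i ord0 = \sum_k (col i mY) k ord0 * u k ord0.
    by rewrite mxE; apply: eq_bigr => k _; rewrite !mxE.
  apply: le_trans (cauchy_schwarz_norm _ _) _; rewrite -!enormE.
  by rewrite -[leRHS]mulr1 ler_pM ?enorm_ge0.
(* The statistics control the centred quantities, the net turning bilinear values into operator
   norms; the hypotheses on the means do the rest. *)
have bounds s z : 0 < s -> near_mean P Z (statistic u) tau s z ->
    [/\ forall x, enorm (z.1.1 *m x) <= kap * (al + s) * enorm x,
        enorm (z.1.2^T *m u) <= kap * (al + s),
        forall i, `|(z.2 : 'M[R]_n) i i| <= kap * (be + s) &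
        forall i, `|(z.1.2^T *m u) i ord0| <= kap * (be + s)].
  move=> sp zs.
  have opnorm (A : 'M[R]_(p, n)) :
      (forall k l, `|bilin A (net_point R k) (net_point R l)| <= 5 * c * al + s) ->
      forall v x, enorm v <= 1 -> enorm x <= 1 ->
        `|bilin A v x| <= 2 * (5 * c * al + s).
    exact: bilin_net.
  have kal : (10 * c + Cx + Cy) * al + 2 * s <= kap * (al + s).
    have : 0 <= Cd * al by rewrite mulr_ge0//; lra.
    have : 0 <= (10 * c + Cx + Cd + Cy) * s by rewrite mulr_ge0//; lra.
    rewrite /kap; lra.
  have kbe : 5 * c * be + s + (Cd + Cy) <= kap * (be + s).
    have : 0 <= (5 * c + Cx + 2) * be by rewrite mulr_ge0//; lra.
    have : 0 <= (10 * c + Cx + Cd + Cy) * s by rewrite mulr_ge0//; lra.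
    have : (Cd + Cy) * 1 <= (Cd + Cy) * be by rewrite ler_wpM2l//; lra.
    rewrite /kap; lra.
  split.
  - have hX : forall x, enorm ((z.1.1 - mX) *m x) <= 2 * (5 * c * al + s) * enorm x.
      apply: enorm_mulmx_bilin; apply: opnorm => k l.
      have := zs (inl (inl (k, l))); rewrite /= (mean_bilin _ _ iX) -bilin_subM.
      exact: ltW.
    move=> x; have -> : z.1.1 *m x = (z.1.1 - mX) *m x + mX *m x.
      by rewrite mulmxBl subrK.
    apply: le_trans (enormD _ _) _.
    have h1 := hX x; have h2 := enorm_mulmx_specnorm mX x.
    have h3 := ler_wpM2r (enorm_ge0 x) EX.
    have h4 := ler_wpM2r (enorm_ge0 x) kal.
    have h5 : 0 <= Cy * al * enorm x by rewrite !mulr_ge0 ?enorm_ge0//; lra.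
    rewrite -/mX in h3; lra.
  - have hY : forall x, enorm ((z.1.2 - mY)^T *m x) <= 2 * (5 * c * al + s) * enorm x.
      apply: enorm_mulmx_bilin => v x v1 x1; rewrite bilin_tr.
      apply: opnorm => // k l.
      have := zs (inl (inr (k, l))); rewrite /= (mean_bilin _ _ iY) -bilin_subM.
      exact: ltW.
    have -> : z.1.2^T *m u = (z.1.2 - mY)^T *m u + mY^T *m u.
      by rewrite linearB/= mulmxBl subrK.
    apply: le_trans (enormD _ _) _.
    have h1 := hY u.
    have h2 : 2 * (5 * c * al + s) * enorm u <= 2 * (5 * c * al + s).
      rewrite -[leRHS]mulr1 ler_wpM2l//.
      have : 0 <= c * al by rewrite mulr_ge0//; lra.
      lra.
    (* There are [n] coordinates of size at most [Cy], and [sqrt n <= al]. *)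
    have h3 : enorm (mY^T *m u) <= Cy * al.
      apply: l2norm_le; first by rewrite mulr_ge0//; lra.
      apply: (@le_trans _ _ (\sum_(i < n) Cy ^+ 2)).
        apply: ler_sum => i _; rewrite -[leLHS]real_normK ?num_real//.
        by rewrite ler_sqr ?nnegrE// ltW.
      rewrite sumr_const card_ord -[_ *+ n]mulr_natr exprMn al2.
      by rewrite ler_wpM2l ?sqr_ge0// ler_nat leq_addl.
    have h4 : 0 <= Cx * al by rewrite mulr_ge0//; lra.
    lra.
  - move=> i; have /ltW := zs (inr (inl i)); rewrite /= /tau => h.
    have h2 := le_trans (ler_specnorm mD i) ED.
    rewrite mxE in h2.
    have := ler_normD ((z.2 : 'M[R]_n) i i - fine 'E_P[fun w => (D w : 'M[R]_n) i i])
      (fine 'E_P[fun w => (D w : 'M[R]_n) i i]).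
    rewrite subrK; lra.
  - move=> i; have /ltW := zs (inr (inr i)); rewrite /= /tau (mean_bilin _ _ iY).
    rewrite !coordY => h.
    have := ler_normD ((z.1.2^T *m u) i ord0 - (mY^T *m u) i ord0) ((mY^T *m u) i ord0).
    by rewrite subrK; have := mYu i; lra.
pose lam s := Lam * ((al + s) * (be + s)).
have lam0 s : 0 < s -> 0 < lam s.
  by move=> sp; rewrite mulr_gt0// mulr_gt0//; lra.
have lam_le s s' : 0 < s -> s <= s' -> lam s <= lam s'.
  by move=> sp ss'; rewrite ler_pM2l// ler_pM//; lra.
have Flip s z z' : 0 < s -> near_mean P Z (statistic u) tau s z ->
    near_mean P Z (statistic u) tau s z' ->
    `|f (product_map u z) - f (product_map u z')| <= lam s * prodnorm (z - z').
  move=> sp /(bounds _ _ sp)[_ Ya Db Yb] /(bounds _ _ sp)[X'a _ D'b _].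
  apply: le_trans (flip _ _) _.
  have -> : lam s = 3 * (kap * (al + s) * (kap * (be + s))) by rewrite /lam /Lam; ring.
  by apply: product_map_lipschitz => //; rewrite mulr_ge0//; lra.
exact: (@subgaussian_locally_lipschitz R (triple p n) (@prodnorm R p n)
  (@prodnorm0 R p n) (@prodnormN R p n) (@prodnormD R p n) d T P Z C c Zsub C0 c0
  _ (statistic u) tau 4 (statistic_lipschitz u1) tau0 tauB
  (f \o product_map u) lam lam0 lam_le Flip s0 s0_ge1 s0_small (ler0n _ _)
  Lam al be Lam0 al1 be1 (fun s => erefl)).
Qed.

(** * From uniform deviations to the three-tail concentration *)

Theorem proposition7p1 (R : realType)
    (d : nat -> nat -> measure_display)
    (T : forall p n : nat, measurableType (d p n))
    (P : forall p n : nat, probability (T p n) R)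
    (X Y : forall p n : nat, T p n -> 'M[R]_(p, n))
    (D : forall p n : nat, T p n -> diagmx R n)
    (rX : forall p n : nat, random_matrix (X p n))
    (rY : forall p n : nat, random_matrix (Y p n))
    (rD : forall p n : nat, random_matrix (fun w => D p n w : 'M[R]_n))
    (cXYD : concentrated P
       (E := fun p n => ('M[R]_(p, n) * 'M[R]_(p, n) * diagmx R n)%type
                        : lmodType R)
       (fun p n => @prodnorm R p n)
       (fun p n w => (X p n w, Y p n w, D p n w))
       (fun p n => [:: (2, 1)]))
    (EX : le_bigO (fun p n => specnorm (mean_matrix (P p n) (X p n)))
                  (fun p n => Num.sqrt (p + n)%:R))
    (ED : le_bigO (fun p n => specnorm (mean_matrix (P p n)
                                          (fun w => D p n w : 'M[R]_n)))
                  (fun p n => 1))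
    (EY : le_bigO (fun p n => \big[Num.max/0]_(i < n)
                   enorm (col i (mean_matrix (P p n) (Y p n))))
                  (fun p n => 1))
    (u : forall p n : nat, 'cV[R]_p)
    (u_le1 : forall p n : nat, enorm (u p n) <= 1) :
  concentrated P
    (E := fun p n => 'cV[R]_p : lmodType R)
    (fun p n => @enorm R p)
    (fun p n w => X p n w *m D p n w *m (Y p n w)^T *m u p n)
    (fun p n => [:: (2, Num.sqrt ((p + n)%:R * ln (n * p)%:R));
                    (1, Num.sqrt (p + n)%:R);
                    (2 / 3, 1)]).
Proof.
have [C [c [C0 c0 Zsub]]] := cXYD.
have [Cx Cx0 EXle] := EX; have [Cd Cd0 EDle] := ED; have [Cy Cy0 EYle] := EY.
have [K [C1 [K0 C10 dev]]] := product_deviation C0 c0 Cx0 Cd0 Cy0.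
exists (C1 * (1 + expR 1)), (2 * (K * (c + 3 * c ^+ 2 + c ^+ 3))); split.
- by rewrite mulr_gt0// addr_gt0// expR_gt0.
- by rewrite !mulr_gt0// !addr_gt0// ?mulr_gt0// exprn_gt0.
move=> p n p0 n0 f flip.
have sub : @subgaussian R (triple p n) (@prodnorm R p n) _ _ (P p n)
    (fun w => (X p n w, Y p n w, D p n w)) C c.
  move=> g glip; have [gi gt] := Zsub p n p0 n0 g glip; split=> // t t0.
  apply: le_trans (gt t t0) _; rewrite big_seq1 /exp_tail oner_eq0/= mulr1.
  by rewrite powR_mulrn// divr_ge0// ltW.
have EDp : specnorm (mean_matrix (P p n) (fun w => D p n w : 'M[R]_n)) <= Cd.
  by have := EDle p n p0 n0; rewrite mulr1.
have EYp i : enorm (col i (mean_matrix (P p n) (Y p n))) <= Cy.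
  have := EYle p n p0 n0; rewrite mulr1; apply: le_trans.
  exact: (le_bigmax _ (fun i => enorm (col i (mean_matrix (P p n) (Y p n))))).
have [fi ft] := dev _ _ (P p n) p n (X p n) (Y p n) (D p n) (u p n) f p0 n0 sub
  (EXle p n p0 n0) EDp EYp (u_le1 p n) flip.
split=> // t t0.
apply: (concentration_tail p0 n0 _ K0 C10 c0 ft t0).
apply: measurableT_comp => //; apply: measurable_funB => //.
by move/measurable_int: fi => /measurable_EFinP.
Qed.
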